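(* Let $\mathcal{M}_1=(V,\mathcal{I}_1)$ and $\mathcal{M}_2=(V,\mathcal{I}_2)$ be matroids on a common ground set $V$ with $|V|=n$, accessible through independence oracles, and let $S\in\mathcal{I}_1\cap\mathcal{I}_2$ be a given common independent set with $|S|=r$. There is a randomized algorithm which with high probability uses $O(n\sqrt{r}\log n)$ independence queries and either determines that $S$ is a common independent set of maximum cardinality or finds an augmenting path in the exchange graph $G(S)$.
   Context: A matroid $\mathcal{M}=(V,\mathcal{I})$ consists of a finite ground set $V$ and a nonempty, downward closed family $\mathcal{I}\subseteq 2^V$ of independent sets satisfying the exchange property. An independence oracle for $\mathcal{M}_i$ answers, for a queried $X\subseteq V$, whether $X\in\mathcal{I}_i$; cost is measured in number of such queries. For a common independent set $S$, the exchange graph $G(S)$ is the directed graph on vertex set $V\cup\{s,t\}$ (with $s,t$ two new vertices), bipartite between $S$ and $\bar S=V\setminus S$, with edges: $(s,v)$ for $v\in\bar S$ iff $S\cup\{v\}\in\mathcal{I}_1$; $(v,t)$ for $v\in\bar S$ iff $S\cup\{v\}\in\mathcal{I}_2$; $(u,v)$ for $u\in S,v\in\bar S$ iff $(S\setminus\{u\})\cup\{v\}\in\mathcal{I}_1$; $(v,u)$ for $v\in\bar S,u\in S$ iff $(S\setminus\{u\})\cup\{v\}\in\mathcal{I}_2$. Viewing a path as a sequence of vertices, an $(s,t)$-path $p$ is chordless if no proper subsequence of $p$ is also an $(s,t)$-path; a chordless $(s,t)$-path in $G(S)$ is called an augmenting path. ''With high probability'' means with probability at least $1-n^{-c}$ for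 an arbitrarily large constant $c$.
   Formalization: The query bound O(n√r log n) is read as O(n√max(1,r) log n), since for r = 0 the literal bound allows no query, although queries are needed to tell whether the empty set is maximum. *)

(* Defs.v *)
From HB Require Import structures.
From mathcomp Require Import all_boot all_order all_algebra.
From mathcomp Require Import boolp reals exp.

Set Implicit Arguments.
Unset Strict Implicit.
Unset Printing Implicit Defensive.

Import Order.TTheory GRing.Theory Num.Theory.

Record matroid (V : finType) := Matroid {
  indep : {set {set V}};
  indep_nonempty : indep != set0;
  indep_down : forall A B : {set V},
    A \subset B -> B \in indep -> A \in indep;
  indep_exchange : forall A B : {set V},
    A \in indep -> B \in indep -> #|A| < #|B| ->
    exists2 x, x \in B :\: A & x |: A \in indep
}.

Definition common_indep (V : finType) (M1 M2 : matroid V) (S : {set V}) :=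
  (S \in indep M1) && (S \in indep M2).

Definition max_common_indep (V : finType) (M1 M2 : matroid V) (S : {set V}) :=
  common_indep M1 M2 S /\
  forall T : {set V}, common_indep M1 M2 T -> #|T| <= #|S|.

(* Vertices of the exchange graph: [inl v] is the element [v] of the ground   *)
(* set, and the two values of [bool] are the extra vertices s and t.          *)
Definition xvertex (V : finType) : finType := (V + bool)%type.
Definition xsource (V : finType) : xvertex V := inr false.
Definition xsink (V : finType) : xvertex V := inr true.

Definition xedge (V : finType) (M1 M2 : matroid V) (S : {set V}) :
    rel (xvertex V) := fun x y =>
  match x, y with
  | inr false, inl v => (v \notin S) && (v |: S \in indep M1)
  | inl v, inr true => (v \notin S) && (v |: S \in indep M2)
  | inl u, inl v =>
         [&& u \in S, v \notin S & v |: (S :\ u) \in indep M1]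
      || [&& u \notin S, v \in S & u |: (S :\ v) \in indep M2]
  | _, _ => false
  end.

(* The sequence [p] lists all the vertices of the path, s and t included.     *)
Definition st_path (V : finType) (M1 M2 : matroid V) (S : {set V})
    (p : seq (xvertex V)) : bool :=
  if p is x :: q then
    [&& x == xsource V, path (xedge M1 M2 S) x q, last x q == xsink V & uniq p]
  else false.

Definition augmenting_path (V : finType) (M1 M2 : matroid V) (S : {set V})
    (p : seq (xvertex V)) :=
  st_path M1 M2 S p /\
  forall q : seq (xvertex V), subseq q p -> st_path M1 M2 S q -> q = p.

(* Randomized algorithms with access to the independence oracles of two       *)
(* matroids on [V]: randomized decision trees, whose next step may depend on  *)
(* the answers to the earlier queries and on the earlier random draws only.   *)
(* [Random m k] draws [i : 'I_m.+1] uniformly, independently of the past.     *)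
Inductive oracle_alg (V : finType) (A : Type) : Type :=
| Return of A
| Query1 of {set V} & (bool -> oracle_alg V A)
| Query2 of {set V} & (bool -> oracle_alg V A)
| Random (m : nat) of ('I_m.+1 -> oracle_alg V A).

(* [prob R M1 M2 a E] is the probability that, run on the oracles of [M1] and *)
(* [M2], the algorithm [a] makes [q] queries and returns [x] with [E q x].    *)
Fixpoint prob (R : realType) (V : finType) (A : Type) (M1 M2 : matroid V)
    (a : oracle_alg V A) (E : nat -> A -> Prop) : R :=
  match a with
  | Return x => (`[< E 0 x >])%:R
  | Query1 X k => prob R M1 M2 (k (X \in indep M1)) (fun q x => E q.+1 x)
  | Query2 X k => prob R M1 M2 (k (X \in indep M2)) (fun q x => E q.+1 x)
  | Random m k => ((\sum_(i < m.+1) prob R M1 M2 (k i) E) / m.+1%:R)%R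
  end.

Inductive outcome (V : finType) : Type :=
| IsMaximum
| FoundPath of seq (xvertex V).

Definition correct_outcome (V : finType) (M1 M2 : matroid V) (S : {set V})
    (o : outcome V) : Prop :=
  match o with
  | IsMaximum => max_common_indep M1 M2 S
  | FoundPath p => augmenting_path M1 M2 S p
  end.

(* For [#|S| > 0] this is C n sqrt(r) ln n with n = #|V| and r = #|S|.  The   *)
(* maximum is there for [S = set0] only, where the formula would allow no     *)
(* query at all, while some are needed to tell whether [set0] is maximum.     *)
Definition query_bound (R : realType) (C : R) (V : finType) (S : {set V}) : R :=
  (C * #|V|%:R * Num.sqrt (maxn 1 #|S|)%:R * ln #|V|%:R)%R.

(* Main.v *)
Require Import Defs.
From mathcomp Require Import all_boot all_order all_algebra.
From mathcomp Require Import boolp reals exp.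
From mathcomp Require Import zify ring lra.

(* The algorithm keeps a set F of visited vertices, reachable from s and      *)
(* closed under out-edges, and a list E of known edges. If v is outside S and *)
(* S + v is dependent, then S - B + v is independent iff v is joined to some  *)
(* u in B, so halving B repeatedly lists d neighbours of v with O(1 + d log   *)
(* n) queries. In each phase, sampling S \ F with density about 1 / sqrt r    *)
(* classifies the other vertices v outside S as heavy (at least about sqrt r  *)
(* out-neighbours in S \ F) or light. The out-edges of a light vertex into S  *)
(* \ F are listed once and for all. A search backwards from t and the heavy   *)
(* vertices then asks for the in-edges of each vertex at most once, since it  *)
(* passes only through light vertices. Either it yields a path from s to t,   *)
(* or a reachable heavy vertex, whose visit adds about sqrt r elements of S   *)
(* to F, or the vertices it reached certify that S is maximum. Hence there    *)
(* are O(sqrt r) phases. A path is made chordless by a backward pass that     *)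
(* removes the chords of the second matroid, after one on the reversed path   *)
(* that removes those of the first: shortening a path creates no chord.       *)
(* Sampling errors affect the cost only.                                      *)

Set Implicit Arguments.
Unset Strict Implicit.
Unset Printing Implicit Defensive.

Import Order.TTheory GRing.Theory Num.Theory.

(** * Randomized decision trees *)

(** Correctness never depends on the random draws: it is proved with [sure], on every branch, and
    only the number of queries is a matter of probability ([whp]). When a phase finds neither a path
    nor a reachable heavy vertex, the set [R] reached backwards is a tight cut: in the first matroid
    [S] spans [R] from inside [R], in the second it spans the complement from inside the complement,
    so no common independent set beats [S] on either side ([max_common_indepP]).

    The query count rests on two budgets. Write n for [#|V|], and take k about log n and K+1 about
    sqrt r. By [indep_exchange_has] and [sure_neighbours], listing d neighbours costs at most 1 +
    2kd. If the classification is right, every phase but the last moves more than (K+1)/8 elements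
    of [S] into [F], so there are O(sqrt r) phases, each costing O(nk) apart from the edges of new
    light vertices; and a vertex becomes light only once, with fewer than 3(K+1) edges to list.
    [sure_phase] proves the progress of one phase and [search_cost] adds up both budgets. A heavy
    test errs with probability at most 2^-m ([whp_heavy_test]); a union bound over tests and phases,
    with m a multiple of k, leaves n^-c. *)

Fixpoint bind (V : finType) (A B : Type) (a : oracle_alg V A)
    (f : A -> oracle_alg V B) : oracle_alg V B :=
  match a with
  | Return x => f x
  | Query1 X g => Query1 X (fun b => bind (g b) f)
  | Query2 X g => Query2 X (fun b => bind (g b) f)
  | Random m g => Random (fun i : 'I_m.+1 => bind (g i) f)
  end.

Notation "'let!' x := a 'in' b" := (bind a (fun x => b))
  (at level 200, x name, a at level 200, b at level 200).

(* [b = false] is the first matroid, [b = true] the second one. *)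
Definition query (V : finType) (b : bool) (X : {set V}) : oracle_alg V bool :=
  if b then Query2 X (@Return V bool) else Query1 X (@Return V bool).

Section Semantics.

Variables (V : finType) (M1 M2 : matroid V).

Definition oracle (b : bool) : matroid V := if b then M2 else M1.

(** Quantifies over all random draws instead of measuring them, so that correctness and worst-case
    costs carry no probability. *)
Fixpoint sure (A : Type) (a : oracle_alg V A) (Q : nat -> A -> Prop) : Prop :=
  match a with
  | Return x => Q 0 x
  | Query1 X g => sure (g (X \in indep M1)) (fun q => Q q.+1)
  | Query2 X g => sure (g (X \in indep M2)) (fun q => Q q.+1)
  | Random m g => forall i : 'I_m.+1, sure (g i) Q
  end.

Lemma sure_imp (A : Type) (a : oracle_alg V A) (P Q : nat -> A -> Prop) :
  sure a P -> (forall q x, P q x -> Q q x) -> sure a Q.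
Proof.
elim: a P Q => [x|X g IH|X g IH|m g IH] P Q /= aP PQ.
- exact: PQ.
- by apply: (IH _ _ _ aP) => q x; apply: PQ.
- by apply: (IH _ _ _ aP) => q x; apply: PQ.
- by move=> i; apply: (IH _ _ _ (aP i)).
Qed.

Lemma sure_bind (A B : Type) (a : oracle_alg V A) (f : A -> oracle_alg V B)
    (P : nat -> A -> Prop) (Q : nat -> B -> Prop) :
  sure a P ->
  (forall q x, P q x -> sure (f x) (fun q' => Q (q + q'))) ->
  sure (bind a f) Q.
Proof.
elim: a P Q => [x|X g IH|X g IH|m g IH] P Q /= aP PQ.
- exact: PQ aP.
- by apply: (IH _ _ _ aP) => q x; apply: PQ.
- by apply: (IH _ _ _ aP) => q x; apply: PQ.
- by move=> i; apply: (IH _ _ _ (aP i)).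
Qed.

Lemma sure_True (A : Type) (a : oracle_alg V A) : sure a (fun _ _ => True).
Proof. by elim: a => //= m g IH i. Qed.

Lemma sure_query (b : bool) (X : {set V}) (Q : nat -> bool -> Prop) :
  Q 1 (X \in indep (oracle b)) -> sure (query b X) Q.
Proof. by case: b. Qed.

Lemma sure_bind_query (A : Type) (b : bool) (X : {set V})
    (f : bool -> oracle_alg V A) (Q : nat -> A -> Prop) :
  sure (f (X \in indep (oracle b))) (fun q => Q q.+1) ->
  sure (let! ans := query b X in f ans) Q.
Proof. by case: b. Qed.

Variable R : realType.
Local Open Scope ring_scope.
Local Notation pr := (@prob R V _ M1 M2).

Lemma prob_ge0 (A : Type) (a : oracle_alg V A) Q : 0 <= pr a Q.
Proof.
elim: a Q => [x|X g IH|X g IH|m g IH] Q //=.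
by apply: divr_ge0 => //; apply: sumr_ge0 => i _.
Qed.

Lemma prob_le (A : Type) (a : oracle_alg V A) (P Q : nat -> A -> Prop) :
  (forall q x, P q x -> Q q x) -> pr a P <= pr a Q.
Proof.
elim: a P Q => [x|X g IH|X g IH|m g IH] P Q /= PQ.
- case: (asboolP (P 0%N x)) => // Px; first by rewrite (asboolT (PQ _ _ Px)).
- by apply: IH => q x; apply: PQ.
- by apply: IH => q x; apply: PQ.
- rewrite ler_wpM2r ?invr_ge0 //.
  by apply: ler_sum => i _; apply: IH.
Qed.

Lemma sure_prob (A : Type) (a : oracle_alg V A) Q : sure a Q -> pr a Q = 1.
Proof.
elim: a Q => [x|X g IH|X g IH|m g IH] Q /= aQ.
- by rewrite asboolT.
- exact: IH.
- exact: IH.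
- under eq_bigr => i _ do rewrite IH //.
  by rewrite sumr_const card_ord divff // pnatr_eq0.
Qed.

Lemma prob_le1 (A : Type) (a : oracle_alg V A) Q : pr a Q <= 1.
Proof.
by rewrite -(sure_prob (sure_True a)); exact: prob_le.
Qed.

Lemma prob_setC (A : Type) (a : oracle_alg V A) Q :
  pr a (fun q x => ~ Q q x) = 1 - pr a Q.
Proof.
elim: a Q => [x|X g IH|X g IH|m g IH] Q //=.
- by rewrite asbool_neg; case: (`[< _ >]) => /=; rewrite ?subrr ?subr0.
- under eq_bigr => i _ do rewrite IH.
  by rewrite sumrB sumr_const card_ord mulrBl divff // pnatr_eq0.
Qed.

Lemma prob_eq0 (A : Type) (a : oracle_alg V A) Q :
  (forall q x, ~ Q q x) -> pr a Q = 0.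
Proof.
move=> nQ; apply/eqP; rewrite eq_le prob_ge0 andbT.
have : 1 <= pr a (fun q x => ~ Q q x).
  by rewrite -(sure_prob (sure_True a)); apply: prob_le => q x _; exact: nQ.
by rewrite prob_setC; lra.
Qed.

(** Meant for bad events [Q]: [d2] bounds them in any case and [d1] is the surplus when [P] occurs.
    Keeping the factor [pr a P] is what produces a power of [h] in [prob_trials_le]. *)
Lemma prob_bind_le (A B : Type) (a : oracle_alg V A) (f : A -> oracle_alg V B)
    (P : nat -> A -> Prop) (Q : nat -> B -> Prop) (d1 d2 : R) :
  (forall q x, P q x -> pr (f x) (fun q' => Q (q + q')%N) <= d1 + d2) ->
  (forall q x, ~ P q x -> pr (f x) (fun q' => Q (q + q')%N) <= d2) ->
  pr (bind a f) Q <= d1 * pr a P + d2.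
Proof.
elim: a P Q => [x|X g IH|X g IH|m g IH] P Q /= fQ1 fQ2.
- case: (asboolP (P 0%N x)) => [Px|nP]; first by rewrite mulr1; exact: fQ1 Px.
  by rewrite mulr0 add0r; exact: fQ2 nP.
- by apply: IH => q x; [apply: fQ1|apply: fQ2].
- by apply: IH => q x; [apply: fQ1|apply: fQ2].
- have -> : d2 = (\sum_(i < m.+1) d2) / m.+1%:R.
    by rewrite sumr_const card_ord -[d2 *+ _]mulr_natr mulfK // pnatr_eq0.
  rewrite mulrA -mulrDl mulr_sumr -big_split /= ler_wpM2r // ?invr_ge0 //.
  by apply: ler_sum => i _; apply: IH => q x; [apply: fQ1|apply: fQ2].
Qed.

Lemma prob_bind_Return (A B : Type) (a : oracle_alg V A) (f : A -> B)
    (Q : nat -> B -> Prop) :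
  pr (let! x := a in Return V (f x)) Q = pr a (fun q x => Q q (f x)).
Proof.
elim: a Q => [x|X g IH|X g IH|m g IH] Q //=; try exact: IH.
by under eq_bigr => i _ do rewrite IH.
Qed.

Lemma prob_bind_query (A : Type) (a : oracle_alg V A) (b : bool)
    (X : A -> {set V}) (Q : nat -> bool -> Prop) :
  pr (let! x := a in query b (X x)) Q =
  pr a (fun q x => Q q.+1 (X x \in indep (oracle b))).
Proof.
elim: a Q => [x|Y g IH|Y g IH|m g IH] Q /=; try exact: IH.
- by rewrite /query /oracle; case: b.
- by under eq_bigr => i _ do rewrite IH.
Qed.

Definition whp (A : Type) (d : R) (a : oracle_alg V A) (Q : nat -> A -> Prop) :=
  1 - d <= pr a Q.

Lemma whp_bind (A B : Type) (d1 d2 : R) (a : oracle_alg V A)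
    (f : A -> oracle_alg V B) (P : nat -> A -> Prop) (Q : nat -> B -> Prop) :
  0 <= d2 -> whp d1 a P ->
  (forall q x, P q x -> whp d2 (f x) (fun q' => Q (q + q')%N)) ->
  whp (d1 + d2) (bind a f) Q.
Proof.
move=> d20 aP PQ; rewrite /whp.
suff : pr (bind a f) (fun q x => ~ Q q x) <= 1 * pr a (fun q x => ~ P q x) + d2.
  by rewrite !prob_setC mul1r; move: aP; rewrite /whp; lra.
apply: prob_bind_le => q x; first by rewrite (le_trans (prob_le1 _ _)) ?lerDl.
by move=> /contrapT /PQ; rewrite prob_setC /whp; lra.
Qed.

Lemma whp_imp (A : Type) (d : R) (a : oracle_alg V A)
    (P Q : nat -> A -> Prop) :
  whp d a P -> (forall q x, P q x -> Q q x) -> whp d a Q.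
Proof. by move=> aP PQ; apply: le_trans aP _; apply: prob_le. Qed.

Lemma whp_sure (A : Type) (d : R) (a : oracle_alg V A)
    (Q : nat -> A -> Prop) : 0 <= d -> sure a Q -> whp d a Q.
Proof. by move=> d0 aQ; rewrite /whp sure_prob //; lra. Qed.

Lemma whp_sureI (A : Type) (d : R) (a : oracle_alg V A)
    (P Q : nat -> A -> Prop) :
  whp d a P -> sure a Q -> whp d a (fun q x => P q x /\ Q q x).
Proof.
rewrite /whp => aP aQ; apply: le_trans aP _.
elim: a P Q aQ => [x|X g IH|X g IH|m g IH] P Q /= aQ.
- by case: (asboolP (P _ _)) => // Px; rewrite asboolT.
- exact: IH.
- exact: IH.
- by rewrite ler_wpM2r ?invr_ge0 //; apply: ler_sum => i _; apply: IH.
Qed.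

End Semantics.

(** * Sampling of out-neighbours *)

Section ExchangeEdges.

Variables (V : finType) (M : matroid V) (S : {set V}).
Hypothesis S_indep : S \in indep M.

(** Exchange S - B + v against [S]. While it is smaller than [S], it can be enlarged by some x of
    [S :&: B], which amounts to removing x from [B]. Once it is as large as [S], only one element of
    [S] is missing from it. *)
Lemma indep_exchange_in (v : V) (B : {set V}) :
  v |: S \notin indep M -> v |: (S :\: B) \in indep M ->
  exists2 u, u \in S :&: B & v |: (S :\ u) \in indep M.
Proof.
move=> SvI; elim: {B}#|B| {-2}B (leqnn #|B|) => [|n IH] B.
  by rewrite leqn0 cards_eq0 => /eqP ->; rewrite setD0 (negPf SvI).
move=> leBn BI; have [SB|nSB] := boolP (S :&: B == set0).
  have SDB : S :\: B = S by rewrite -[in RHS](setID S B) (eqP SB) set0U.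
  by rewrite SDB (negPf SvI) in BI.
have vS : v \notin S.
  by apply: contra SvI => vS; rewrite (setUidPr _) ?sub1set.
have [lt|ge] := ltnP #|v |: (S :\: B)| #|S|.
  have [x] := indep_exchange BI S_indep lt.
  rewrite !inE negb_or => /andP[/andP[xv]]; rewrite negb_and negbK.
  move=> /orP[xB xS|/negPf xS]; last by rewrite xS.
  have -> : x |: (v |: S :\: B) = v |: (S :\: (B :\ x)).
    apply/setP => y; rewrite !inE; case: eqP => [->|] /=; last by [].
    by rewrite xS orbT.
  have /IH/[apply] : #|B :\ x| <= n.
    by move: leBn; rewrite (cardsD1 x) xB add1n ltnS.
  by case=> u; rewrite !inE => /and3P[uS ux uB] uI; exists u; rewrite // inE uS.
have [u uSB] := set0Pn _ nSB; have /setIP[uS uB] := uSB.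
exists u => //; suff <- : S :\: B = S :\ u by [].
apply/eqP; rewrite eqEcard; apply/andP; split; first by rewrite setDS ?sub1set.
move: ge; rewrite cardsU1 !inE (negPf vS) /= andbF /= (cardsD1 u S) uS.
by rewrite add1n add1n ltnS.
Qed.

(** The basis of group testing: one query examines all of [l] at once. The converse of the exchange
    argument is downward closure. *)
Lemma indep_exchange_has (v : V) (l : seq V) : v |: S \notin indep M ->
  (v |: (S :\: [set x in l]) \in indep M) =
  has (fun u => (u \in S) && (v |: (S :\ u) \in indep M)) l.
Proof.
move=> SvI; apply/idP/hasP => [/(indep_exchange_in SvI)[u]|[u ul /andP[uS]]].
  by rewrite !inE => /andP[uS ul] uI; exists u; rewrite ?uS.
by apply: indep_down; rewrite setUS // setDS // sub1set inE.
Qed.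

End ExchangeEdges.

Section Sampling.

Variables (R : realType) (V : finType) (M1 M2 : matroid V).
Local Open Scope ring_scope.
Local Notation pr := (@prob R V _ M1 M2).

(* Every element of [l] is kept independently with probability 1 / K.+1. *)
Fixpoint sample (K : nat) (l : seq V) : oracle_alg V (seq V) :=
  if l is u :: l' then
    Random (fun i : 'I_K.+1 =>
      let! B := sample K l' in Return V (if i == ord0 then u :: B else B))
  else Return V [::].

Lemma sure_sample K l : sure M1 M2 (sample K l) (fun q _ => q = 0%N).
Proof.
elim: l => [|u l IH] //= i.
by apply: sure_bind IH _ => q B ->.
Qed.

Lemma prob_sample_miss K (p : pred V) l :
  pr (sample K l) (fun _ B => ~~ has p B) = (K%:R / K.+1%:R) ^+ count p l.
Proof.
elim: l => [|u l IH] /=; first by rewrite asboolT.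
under eq_bigr => i _ do rewrite prob_bind_Return.
rewrite big_ord_recl eqxx /=.
under [X in _ + X]eq_bigr => i _ do rewrite IH.
rewrite sumr_const card_ord.
have [pu|npu] /= := boolP (p u).
  rewrite prob_eq0 // add0r exprS -[_ *+ _]mulr_natr -mulrA.
  by rewrite [X in _ = X]mulrC.
rewrite IH -mulrS -[_ *+ _]mulr_natr mulfK ?pnatr_eq0 //.
Qed.

(** Bernoulli's inequality for the inverse ratio 1 + 1/K, with K = 0 apart. *)
Lemma ratio_expn_le K : (K%:R / K.+1%:R) ^+ K.+1 <= 2^-1 :> R.
Proof.
have K0 : 0 < K.+1%:R :> R by rewrite ltr0n.
have [->|Kpos] := posnP K; first by rewrite mul0r expr0n /= invr_ge0.
have K1 : 0 < K%:R :> R by rewrite ltr0n.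
suff: 2 <= (K.+1%:R / K%:R) ^+ K.+1 :> R.
  rewrite -[_ / K.+1%:R]invf_div exprVn => h.
  by rewrite lef_pV2 ?posrE ?ltr0n ?exprn_gt0 ?divr_gt0.
suff bern n : 1 + n%:R / K%:R <= (K.+1%:R / K%:R) ^+ n :> R.
  apply: le_trans (bern _); rewrite -[2]/(1 + 1 : R) lerD2l ler_pdivlMr //.
  by rewrite mul1r ler_nat.
elim: n => [|n IH]; first by rewrite mul0r addr0.
rewrite exprS; apply: (@le_trans _ _ (K.+1%:R / K%:R * (1 + n%:R / K%:R))).
  have -> : K.+1%:R / K%:R = 1 + K%:R^-1 :> R.
    by rewrite -addn1 natrD mulrDl divff ?gt_eqF // mul1r.
  rewrite -[n.+1]addn1 natrD mulrDl mul1r.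
  have : 0 <= n%:R / K%:R / K%:R :> R by rewrite !divr_ge0.
  lra.
by rewrite ler_wpM2l // divr_ge0.
Qed.

(** The union bound, in the form 1 - x^d <= d (1 - x). *)
Lemma prob_sample_hit_le K (p : pred V) l :
  pr (sample K l) (fun _ B => has p B) <= (count p l)%:R / K.+1%:R.
Proof.
apply: (@le_trans _ _ (1 - pr (sample K l) (fun _ B => ~~ has p B))).
  by rewrite -prob_setC; apply: prob_le => _ B ->.
rewrite prob_sample_miss.
set x := _ / _; have -> : (count p l)%:R / K.+1%:R = (count p l)%:R * (1 - x).
  rewrite /x -[X in X - _](@divff _ K.+1%:R) ?pnatr_eq0 // -mulrBl.
  by rewrite -natrB ?leqnSn // subSnn div1r.
have x1 : x <= 1 by rewrite ler_pdivrMr ?ltr0n // mul1r ler_nat leqnSn.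
have x0 : 0 <= x by rewrite divr_ge0.
elim: (count p l) => [|n IH]; first by rewrite expr0 mul0r subrr.
rewrite exprS -[n.+1]addn1 natrD.
have : x ^+ n <= 1 by rewrite exprn_ile1.
have : 0 <= x ^+ n by rewrite exprn_ge0.
nra.
Qed.

Fixpoint trials (t : oracle_alg V bool) (j : nat) : oracle_alg V (seq bool) :=
  if j is j'.+1 then
    let! b := t in let! l := trials t j' in Return V (b :: l)
  else Return V [::].

Lemma sure_trials t j : sure M1 M2 t (fun q _ => q = 1%N) ->
  sure M1 M2 (trials t j) (fun q l => q = j /\ size l = j).
Proof.
move=> t1; elim: j => [|j IH] //=.
apply: sure_bind t1 _ => q b ->; apply: sure_bind IH _ => q' l [-> <-] /=.
by rewrite addn0.
Qed.

(* The bound 2^j h^m counts the at most 2^j outcomes with m answers [b0]. *)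
Lemma prob_trials_le t (b0 : bool) (h : R) j m :
  pr t (fun _ b => b = b0) <= h ->
  pr (trials t j) (fun _ l => (m <= count_mem b0 l)%N) <= 2 ^+ j * h ^+ m.
Proof.
move=> th; have h0 : 0 <= h := le_trans (prob_ge0 _ _ _ _ _) th.
elim: j m => [|j IH] m /=.
  case: m => [|m]; first by rewrite asboolT // !expr0 mul1r.
  by rewrite asboolF // expr0 mul1r exprn_ge0.
case: m => [|m].
  by rewrite expr0 mulr1 (le_trans (prob_le1 _ _ _ _ _)) // exprn_ege1 // ler1n.
have a0 n : 0 <= 2 ^+ j * h ^+ n by rewrite mulr_ge0 ?exprn_ge0.
apply: (@le_trans _ _ (2 ^+ j * h ^+ m * pr t (fun _ b => b = b0)
                       + 2 ^+ j * h ^+ m.+1)); last first.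
  have := ler_wpM2l (a0 m) th; rewrite !exprS; nra.
apply: prob_bind_le => q b.
  move=> ->; rewrite prob_bind_Return /= eqxx.
  by apply: le_trans (IH m) _; rewrite lerDl.
move=> /eqP/negPf nb; rewrite prob_bind_Return /= nb.
exact: IH m.+1.
Qed.

Variable S : {set V}.
Hypothesis S_indep : S \in indep M2.
Variables (K m : nat).

Definition outdeg (U : {set V}) (v : V) : nat :=
  count (fun u => (u \in S) && (v |: (S :\ u) \in indep M2)) (enum U).

Definition trial (U : {set V}) (v : V) : oracle_alg V bool :=
  let! B := sample K (enum U) in query true (v |: (S :\: [set x in B])).

(* A trial succeeds with probability at most d / K.+1 and fails with          *)
(* probability (K / K.+1)^d, where d is the out-degree: the thresholds        *)
(* K.+1 / 8 and 3 K.+1 of [whp_heavy_test] make this at most 1/8.             *)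
Definition heavy_test (U : {set V}) (v : V) : oracle_alg V bool :=
  let! l := trials (trial U v) m.*2 in Return V (m <= count_mem true l)%N.

Lemma sure_trial U v : sure M1 M2 (trial U v) (fun q _ => q = 1%N).
Proof.
by apply: sure_bind (sure_sample _ _) _ => q B ->; exact: sure_query.
Qed.

Lemma sure_heavy_test U v :
  sure M1 M2 (heavy_test U v) (fun q _ => q = m.*2).
Proof.
apply: sure_bind (sure_trials _ (sure_trial U v)) _ => q l [-> _] /=.
by rewrite addn0.
Qed.

(** The two conclusions overlap, so a wrong answer is possible only at a small or a large
    out-degree; there a single trial misleads with probability at most 1/8, and a wrong majority
    needs at least m misleading trials out of 2m. *)
Lemma whp_heavy_test U v : v |: S \notin indep M2 ->
  whp M1 M2 (2 ^- m : R) (heavy_test U v)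
    (fun _ b => if b then (K.+1 < 8 * outdeg U v)%N
                else (outdeg U v < 3 * K.+1)%N).
Proof.
move=> vI; set d := outdeg U v.
(* The bound of [prob_trials_le] for 2m trials, m of them misleading. *)
have halves : 2 ^- m = 2 ^+ m.*2 * 8^-1 ^+ m :> R.
  rewrite -addnn exprD -mulrA mulrC -exprMn -exprVn.
  have -> : 8^-1 = 2^-1 * 2^-1 * 2^-1 :> R by field.
  by rewrite -!exprMn; congr (_ ^+ _); field.
have Kp : 0 < K.+1%:R :> R by rewrite ltr0n.
have trialE Q : pr (trial U v) (fun _ b => Q b) = pr (sample K (enum U))
    (fun _ B => Q (has (fun u => (u \in S) && (v |: (S :\ u) \in indep M2)) B)).
  rewrite prob_bind_query; congr prob; apply/funext => _; apply/funext => B.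
  by rewrite (indep_exchange_has S_indep).
have [small|] := leqP (8 * d) K.+1.
  rewrite /whp halves prob_bind_Return.
  have hit : pr (trial U v) (fun _ b => b = true) <= 8^-1.
    rewrite (trialE (fun b => b = true)).
    apply: le_trans (prob_sample_hit_le K _ _) _; rewrite -/d.
    by rewrite ler_pdivrMr // mulrC ler_pdivlMr // -natrM ler_nat mulnC.
  have := prob_trials_le m.*2 m hit.
  rewrite -[X in X <= _]opprK lerNl -(lerD2l 1) -prob_setC.
  move=> /le_trans; apply; apply: prob_le => q l /negP/negPf ->.
  by rewrite ltnNge; apply/negP; lia.
(* Between the two thresholds either answer is accepted. *)
have [big _|small big] := leqP (3 * K.+1) d; last first.
  apply: whp_sure; first by rewrite invr_ge0 exprn_ge0.
  by apply: sure_imp (sure_True _ _ _) _ => q [].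
have miss : pr (trial U v) (fun _ b => b = false) <= 8^-1.
  rewrite (trialE (fun b => b = false)).
  have -> : pr (sample K (enum U)) (fun _ B =>
     has (fun u => (u \in S) && (v |: (S :\ u) \in indep M2)) B = false) =
     pr (sample K (enum U)) (fun _ B =>
     ~~ has (fun u => (u \in S) && (v |: (S :\ u) \in indep M2)) B).
    congr prob; apply/funext => _; apply/funext => B; apply/propext.
    by split=> [->|/negPf].
  rewrite prob_sample_miss -/(outdeg U v) -/d.
  have x0 : 0 <= K%:R / K.+1%:R :> R by rewrite divr_ge0.
  have x1 : K%:R / K.+1%:R <= 1 :> R.
    by rewrite ler_pdivrMr // mul1r ler_nat leqnSn.
  apply: (@le_trans _ _ ((K%:R / K.+1%:R) ^+ (3 * K.+1))).
    by rewrite ler_wiXn2l.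
  rewrite mulnC exprM; have -> : 8^-1 = 2^-1 ^+ 3 :> R by field.
  by rewrite lerXn2r ?nnegrE ?ratio_expn_le ?exprn_ge0 ?invr_ge0.
have := prob_trials_le m.*2 m miss; rewrite -halves => cnt.
have ok : whp M1 M2 (2 ^- m : R) (trials (trial U v) m.*2)
    (fun _ l => ~ (m <= count_mem false l)%N).
  by rewrite /whp prob_setC lerD2l lerN2.
rewrite /whp prob_bind_Return.
apply: le_trans (whp_sureI ok (sure_trials m.*2 (sure_trial U v))) _.
apply: prob_le => q l [/negP]; rewrite -ltnNge => lt [_ sz].
suff -> : (m <= count_mem true l)%N by lia.
have := count_predC (pred1 true) l; rewrite sz -addnn.
have -> : count (predC (pred1 true)) l = count_mem false l.
  by apply: eq_count => -[].
lia.
Qed.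

Fixpoint classify (U : {set V}) (vs : seq V) : oracle_alg V (seq V) :=
  if vs is v :: vs' then
    let! b := heavy_test U v in
    let! H := classify U vs' in
    Return V (if b then v :: H else H)
  else Return V [::].

Lemma whp_classify U vs : (forall v, v \in vs -> v |: S \notin indep M2) ->
  whp M1 M2 ((size vs)%:R * 2 ^- m : R) (classify U vs)
    (fun q H => [/\ (q <= size vs * m.*2)%N,
       forall v, v \in H -> (K.+1 < 8 * outdeg U v)%N &
       forall v, v \in vs -> v \notin H -> (outdeg U v < 3 * K.+1)%N]).
Proof.
elim: vs => [|v vs IH] vsI.
  by apply: whp_sure; rewrite ?mul0r.
have d0 : 0 <= 2 ^- m :> R by rewrite invr_ge0 exprn_ge0.
rewrite /= -addn1 natrD mulrDl mul1r addrC.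
apply: whp_bind (whp_sureI (whp_heavy_test U _) (sure_heavy_test U v)) _.
- by rewrite mulr_ge0.
- by apply: vsI; rewrite mem_head.
move=> q b [vb ->].
rewrite -[_ * _]addr0; apply: whp_bind (IH _) _ => //.
  by move=> w wvs; apply: vsI; rewrite inE wvs orbT.
move=> q' H [q'H Hh Hl]; apply: whp_sure => //=; split.
- by rewrite addn0 ?addn1 ?mulSn leq_add2l.
- move=> w; case: b vb => [vb|_]; last exact: Hh.
  by rewrite inE => /predU1P[->//|]; exact: Hh.
- move=> w; rewrite inE => /predU1P[->|wvs]; case: b vb => [_|vb] //.
  + by rewrite mem_head.
  + by rewrite inE negb_or => /andP[_]; exact: Hl.
  + exact: Hl.
Qed.

End Sampling.

(** * Chordless paths *)

Section Chords.

Variable T : eqType.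
Implicit Types (e : rel T) (s : seq T).

(** Only edges from an entry to a later, non-consecutive one count: a subsequence keeps the order,
    so backward edges shorten nothing. *)
Fixpoint nochord e s : bool :=
  if s is x :: s' then all (fun z => ~~ e x z) (behead s') && nochord e s'
  else true.

Lemma subseq_behead s1 s2 : subseq s1 s2 -> subseq (behead s1) (behead s2).
Proof.
case: s2 => [|y s2]; first by case: s1.
case: s1 => [|x s1] /=; first by rewrite sub0seq.
by case: eqP => // _; apply: subseq_trans; exact: subseq_cons.
Qed.

(** Entries that are not consecutive after deletions were not consecutive before. Hence the second
    pass of [finish] does not undo the first. *)
Lemma nochord_subseq e s1 s2 : subseq s1 s2 -> nochord e s2 -> nochord e s1.
Proof.
elim: s2 s1 => [|y s2 IH] [|x s1] //=.
case: eqP => [->|_] sub /andP[ys nc2]; last exact: (IH (x :: s1)).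
rewrite (IH _ sub nc2) andbT; apply/allP => z zs.
by apply: (allP ys); exact: mem_subseq (subseq_behead sub) z zs.
Qed.

Lemma nochord_rcons e s z :
  nochord e (rcons s z) =
  all (fun x => ~~ e x z) (take (size s).-1 s) && nochord e s.
Proof.
elim: s => [|x [|y s] IH] //=.
move: IH => /= ->; rewrite all_rcons -!andbA; congr andb.
by rewrite andbCA.
Qed.

Lemma nochord_rev e s : nochord e (rev s) = nochord (fun x y => e y x) s.
Proof.
elim: s => [|x s IH] //=; rewrite rev_cons nochord_rcons IH; congr (_ && _).
rewrite size_rev take_rev all_rev; congr all.
by case: s {IH} => [|y s] //=; rewrite subSnn /= drop0.
Qed.

Lemma nochord_or e1 e2 s :
  nochord (fun x y => e1 x y || e2 x y) s = nochord e1 s && nochord e2 s.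
Proof.
elim: s => [|x s IH] //=; rewrite IH andbACA; congr (_ && _).
by rewrite -all_predI; apply: eq_all => z /=; rewrite negb_or.
Qed.

Lemma eq_nochord e1 e2 s : e1 =2 e2 -> nochord e1 s = nochord e2 s.
Proof.
move=> e12; elim: s => [|x s IH] //=; rewrite IH; congr (_ && _).
by apply: eq_all => z; rewrite e12.
Qed.

(** If the successor of a vertex occurred again later, the edge to it would also be a chord to that
    later occurrence. Only the first vertex needs a hypothesis. *)
Lemma nochord_uniq e x s :
  path e x s -> nochord e (x :: s) -> x \notin s -> uniq (x :: s).
Proof.
elim: s x => [|y s IH] x //= /andP[exy ys] /andP[xs nc] xnot.
rewrite xnot /=; apply: IH => //.
by apply/negP => /(allP xs); rewrite exy.
Qed.

(** The first vertex skipped by [q] would be jumped over by a chord, and stopping early would repeat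
    the last vertex. *)
Lemma nochord_path_eq e x p q : nochord e (x :: p) -> uniq (x :: p) ->
  path e x q -> subseq q p -> last x q = last x p -> q = p.
Proof.
elim: p x q => [|y p IH] x [|z q] //=.
  move=> _ /andP[xp _] _ _ lp; move: xp.
  by rewrite [X in X \notin _]lp mem_last.
move=> /andP[xp nc] /andP[_ u] /andP[exz zq].
case: eqP => [zy|_] sub; last first.
  have zp : z \in p by apply: (mem_subseq sub); rewrite mem_head.
  by have := allP xp z zp; rewrite exz.
by rewrite zy in zq *; move=> lpq; rewrite (IH y q).
Qed.

Fixpoint last_suffix (P : pred T) s : seq T :=
  if s is x :: s' then
    if has P s' then last_suffix P s' else if P x then s else [::]
  else [::].

(** Cutting at the last out-neighbour removes all chords from a vertex at once. The bound on [count]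
    says that all out-neighbours but one are among the removed entries [s0], which can thus pay for
    listing them. *)
Lemma last_suffixP (P : pred T) s : has P s ->
  exists s0 y s1, [/\ s = s0 ++ y :: s1, last_suffix P s = y :: s1, P y,
                      ~~ has P s1 & count P s <= (size s0).+1].
Proof.
elim: s => [|x s IH] //=; case: ifP => [Ps _|Ps].
  have [s0 [y [s1 [-> -> Py nPs1 cnt]]]] := IH Ps.
  by exists (x :: s0), y, s1; split=> //=; case: (P x); rewrite ?ltnS // leqW.
rewrite orbF => Px; exists [::], x, s; split=> //=; rewrite ?Px ?Ps //.
by move: Ps; rewrite has_count lt0n => /negbFE/eqP ->.
Qed.

End Chords.

Lemma nochord_map (T1 T2 : eqType) (f : T1 -> T2) (e : rel T2) s :
  nochord e (map f s) = nochord (fun x y => e (f x) (f y)) s.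
Proof.
elim: s => [|x s IH] //=; rewrite IH; congr (_ && _).
by case: s {IH} => //= y s; rewrite all_map.
Qed.

(** The accounting used by all searches: elements listed outside [R] enter [R'], so each is charged
    once. *)
Lemma leq_card_setDU (T : finType) (C R R' : {set T}) (s : seq T) :
  uniq s -> {subset s <= C :\: R} -> R \subset R' -> {subset s <= R'} ->
  #|C :\: R'| + size s <= #|C :\: R|.
Proof.
move=> us sCR RR' sR'; have <- : #|[set x in s]| = size s.
  by rewrite cardsE; exact/card_uniqP.
rewrite -cardsUI; have -> : (C :\: R') :&: [set x in s] = set0.
  apply/setP => x; rewrite !inE; apply/negP => /andP[/andP[/negP nR' _]].
  by move=> /sR'.
rewrite cards0 addn0 subset_leq_card //; apply/subsetP => x.
rewrite !inE => /orP[/andP[xR' ->]|/sCR]; last by rewrite inE.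
by rewrite andbT; apply: contra xR'; exact: (subsetP RR').
Qed.

(** Amortization with potential 2k per vertex of the shortened path: removed vertices release 2k
    each for the neighbours listed, and a new vertex brings 4k + 1, namely 1 for the first query, 2k
    for the surviving neighbour and 2k for its own potential. *)
Lemma shortcut_cost k q q' a s0 s1 p :
  q + 2 * k * a <= (4 * k + 1) * p -> a.+1 = s0 + s1.+1 ->
  q' <= 1 + 2 * k * s0.+1 ->
  q + (q' + 0) + 2 * k * s1.+1 <= (4 * k + 1) * p.+1.
Proof. by move=> c /eqP; rewrite addnS eqSS => /eqP e; subst a; lia. Qed.

(** * Query procedures and removal of chords *)

Section Algorithm.

Variables (V : finType) (S : {set V}) (k : nat).

(** [j] is the remaining depth of the halving: with at most 2^j entries in [l], a positive answer at
    depth 0 identifies the neighbour. *)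
Fixpoint neighbours (b : bool) (v : V) (j : nat) (l : seq V) :
    oracle_alg V (seq V) :=
  let! ans := query b (v |: (S :\: [set x in l])) in
  if ans then
    if j is j'.+1 then
      let! l1 := neighbours b v j' (take (size l)./2 l) in
      let! l2 := neighbours b v j' (drop (size l)./2 l) in
      Return V (l1 ++ l2)
    else Return V l
  else Return V [::].

Fixpoint addable_among (b : bool) (vs : seq V) : oracle_alg V (seq V) :=
  if vs is v :: vs' then
    let! ans := query b (v |: S) in
    let! l := addable_among b vs' in
    Return V (if ans then v :: l else l)
  else Return V [::].

Fixpoint out_edges (U : {set V}) (vs : seq V) : oracle_alg V (seq (V * V)) :=
  if vs is v :: vs' then
    let! l := neighbours true v k (enum U) in
    let! E := out_edges U vs' in
    Return V ([seq (v, u) | u <- l] ++ E)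
  else Return V [::].

Fixpoint visit (F : {set V}) (E : seq (V * V)) (vs : seq V) :
    oracle_alg V ({set V} * seq (V * V)) :=
  if vs is v :: vs' then
    let! l := neighbours true v k (enum (S :\: F)) in
    visit (v |: F :|: [set u in l]) ([seq (v, u) | u <- l] ++ E) vs'
  else Return V (F, E).

Fixpoint reverse_search (Lt : {set V}) (fuel : nat) (R : {set V})
    (E : seq (V * V)) (todo : seq V) : oracle_alg V (seq (V * V)) :=
  if (fuel, todo) is (fuel'.+1, v :: todo') then
    let! l := neighbours false v k (enum (S :\: R)) in
    let R1 := R :|: [set u in l] in
    let ws := [seq w <- enum (Lt :\: R1) | has (fun u => (w, u) \in E) l] in
    reverse_search Lt fuel' (R1 :|: [set w in ws])
      ([seq (u, v) | u <- l] ++ E) (todo' ++ ws)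
  else Return V E.

(** The tail is treated first, so that the neighbours of [x] are sought only on the vertices that
    survive and their number can be charged to the vertices removed. *)
Fixpoint shortcut (b : bool) (x : V) (p : seq V) : oracle_alg V (seq V) :=
  if p is y :: p' then
    let! Q := shortcut b y p' in
    if x \in S then Return V (y :: Q) else
    let! N := neighbours b x k (y :: Q) in
    Return V (last_suffix (fun u => u \in N) (y :: Q))
  else Return V [::].

Definition finish (a : V) (p : seq V) : oracle_alg V (outcome V) :=
  let! Q := shortcut false (last a p) (rev (belast a p)) in
  let! Q' := shortcut true a (behead (rev (last a p :: Q))) in
  Return V
    (FoundPath (xsource V :: rcons [seq inl v | v <- a :: Q'] (xsink V))).

Definition known (E : seq (V * V)) : rel V := fun x y => (x, y) \in E.

(** * Correctness and cost of the query procedures *)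

Section Correctness.

Variables (M1 M2 : matroid V).
Hypothesis S_common : common_indep M1 M2 S.
Local Notation M b := (oracle M1 M2 b).

Lemma S_indep b : S \in indep (M b).
Proof. by case/andP: S_common; case: b. Qed.

(** [addable false] consists of the out-neighbours of s, [addable true] of the in-neighbours of
    t. *)
Definition addable b := [set v | (v \notin S) && (v |: S \in indep (M b))].

(** Oriented from outside [S] into [S] for both matroids, thus against the exchange graph when
    [b = false]. The same query procedure then lists out-edges for [true] and in-edges for
    [false]. *)
Definition exarc b : rel V := fun x y =>
  [&& x \notin S, y \in S & x |: (S :\ y) \in indep (M b)].

(* [exedge true] is the exchange graph on [V], [exedge false] its reverse. *)
Definition exedge b : rel V := fun x y => exarc b x y || exarc (~~ b) y x.

Lemma exedgeN b x y : exedge (~~ b) x y = exedge b y x.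
Proof. by rewrite /exedge negbK orbC. Qed.

Lemma xedge_inl x y : xedge M1 M2 S (inl x) (inl y) = exedge true x y.
Proof.
by rewrite /= /exedge /exarc /= orbC; congr (_ || _); rewrite andbCA.
Qed.

Lemma notin_addable b v :
  v \notin S -> v \notin addable b -> v |: S \notin indep (M b).
Proof. by rewrite inE => ->. Qed.

(** Every positive node of the halving tree above the leaves spawns two queries and lies above a
    neighbour found; a neighbour has at most [j] such ancestors, whence 2j queries for each, plus
    the root. *)
Lemma sure_neighbours b v j l :
  v \notin S -> v \notin addable b -> size l <= 2 ^ j ->
  sure M1 M2 (neighbours b v j l)
    (fun q r => r = filter (exarc b v) l /\ q <= 1 + 2 * j * size r).
Proof.
move=> vS vb; have vI := notin_addable vS vb.
have hasE := indep_exchange_has (S_indep b) _ vI.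
have arcE : exarc b v =1 fun u => (u \in S) && (v |: (S :\ u) \in indep (M b)).
  by move=> u; rewrite /exarc vS.
elim: j l => [|j IH] l szl.
  apply: sure_bind_query; rewrite hasE -(eq_has arcE).
  case: l szl => [|u [|w l]] //= _.
  by rewrite orbF; case: (exarc b v u).
apply: sure_bind_query; rewrite hasE -(eq_has arcE).
case: ifP => [hl|hl] /=; last first.
  split=> //; apply/esym/eqP.
  by rewrite -size_eq0 size_filter -leqn0 leqNgt -has_count hl.
have szt : size (take (size l)./2 l) <= 2 ^ j.
  by rewrite size_take; move: szl; rewrite expnS; case: ifP; lia.
have szd : size (drop (size l)./2 l) <= 2 ^ j.
  by rewrite size_drop; move: szl; rewrite expnS; lia.
apply: sure_bind (IH _ szt) _ => q1 r1 [-> q1le].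
apply: sure_bind (IH _ szd) _ => q2 r2 [-> q2le] /=.
rewrite -filter_cat cat_take_drop; split=> //.
have : 0 < size (filter (exarc b v) l) by rewrite size_filter -has_count.
have : size (filter (exarc b v) l) =
    size (filter (exarc b v) (take (size l)./2 l)) +
    size (filter (exarc b v) (drop (size l)./2 l)).
  by rewrite -size_cat -filter_cat cat_take_drop.
nia.
Qed.

Lemma sure_addable_among b vs : {subset vs <= ~: S} ->
  sure M1 M2 (addable_among b vs)
    (fun q l => q = size vs /\ l = filter (mem (addable b)) vs).
Proof.
elim: vs => [|v vs IH] //= vsS.
apply: sure_bind_query; apply: sure_bind (IH _) _ => [w wvs|q' l [-> ->] /=].
  by apply: vsS; rewrite inE wvs orbT.
rewrite addn0; split=> //; rewrite inE.
by have := vsS v (mem_head _ _); rewrite inE => ->.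
Qed.

Lemma sure_shortcut b x p :
  path (exedge b) x p -> size p <= 2 ^ k ->
  all (fun v => v \notin addable b) (belast x p) ->
  sure M1 M2 (shortcut b x p)
    (fun q Q => [/\ path (exedge b) x Q, last x Q = last x p, subseq Q p,
       nochord (exarc b) (x :: Q) &
       q + 2 * k * size Q <= (4 * k + 1) * size p]).
Proof.
elim: p x => [|y p IH] x; first by split; rewrite ?muln0.
rewrite [path _ _ _]/= [all _ _]/= [size _]/= => /andP[xy yp] szp /andP[xb pb].
apply: sure_bind (IH _ yp (ltnW szp) pb) _ => q Q [yQ lQ sub nc cost].
have szQ := size_subseq sub.
have subyQ : subseq (y :: Q) (y :: p) by rewrite /= eqxx.
have [xS|xS] := boolP (x \in S).
  split.
  - by rewrite /= xy.
  - by [].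
  - exact: subyQ.
  - by apply/andP; split; [apply/allP => z _; rewrite /exarc xS|exact: nc].
  - by rewrite /=; clear -szQ cost; lia.
have : size (y :: Q) <= 2 ^ k by apply: leq_ltn_trans szQ _.
move=> /(sure_neighbours xS xb) nb.
apply: sure_bind nb _ => q' N [-> q'le].
set s := y :: Q.
(* As [x] is outside [S], the edge to [y] comes from matroid [b]; hence some neighbour is found and
   the path is not cut to nothing. *)
have arcxy : exarc b x y.
  by have /orP[//|/and3P[_ xS' _]] := xy; rewrite xS' in xS.
have memN u : u \in s -> (u \in filter (exarc b x) s) = exarc b x u.
  by move=> us; rewrite mem_filter us andbT.
have hs : has (fun u => u \in filter (exarc b x) s) s.
  by apply/hasP; exists y; rewrite ?memN ?mem_head.
have [s0 [z [s1 [sE -> zN ns1 cnt]]]] := last_suffixP hs.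
have xz : exarc b x z by move: zN; rewrite mem_filter => /andP[].
have zs1 : path (exedge b) z s1.
  have : path (exedge b) x s by rewrite /= xy.
  by rewrite sE cat_path /= => /and3P[].
have subs : subseq (z :: s1) s by rewrite sE suffix_subseq.
split=> /=.
- by rewrite /exedge xz.
- by have := congr1 (last x) sE; rewrite last_cat /= => <-.
- exact: subseq_trans subs subyQ.
- apply/andP; split; last exact: nochord_subseq subs nc.
  apply/allP => w ws1; apply: contra ns1 => xw; apply/hasP; exists w => //.
  by rewrite memN // sE mem_cat inE ws1 !orbT.
- have szs : (size Q).+1 = size s0 + (size s1).+1.
    by have := congr1 size sE; rewrite size_cat.
  have szN : size (filter (exarc b x) s) <= (size s0).+1.
    rewrite size_filter; apply: leq_trans cnt; rewrite eq_leq //.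
    by apply: eq_in_count => u us; rewrite memN.
  apply: shortcut_cost cost szs (leq_trans q'le _).
  by rewrite leq_add2l leq_mul2l szN orbT.
Qed.

(** The path meets the sources only at its start and the sinks only at its end, so s and t add no
    chord. *)
Lemma augmenting_path_nochord a p :
  a \in addable false -> path (exedge true) a p -> last a p \in addable true ->
  all (fun v => v \notin addable false) p ->
  all (fun v => v \notin addable true) (belast a p) ->
  nochord (exedge true) (a :: p) ->
  augmenting_path M1 M2 S
    (xsource V :: rcons [seq inl v | v <- a :: p] (xsink V)).
Proof.
move=> aA ap lT pA pT nc; set xs := rcons _ _.
have pathx : path (xedge M1 M2 S) (xsource V) xs.
  rewrite rcons_path /=; apply/andP; split; last first.
    by rewrite last_map /=; move: lT; rewrite inE.
  apply/andP; split; first by move: aA; rewrite inE.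
  by rewrite path_map; apply: sub_path ap => x y; rewrite -xedge_inl.
have ncx : nochord (xedge M1 M2 S) (xsource V :: xs).
  have ncxs : nochord (xedge M1 M2 S) xs.
    rewrite /xs nochord_rcons nochord_map; apply/andP; split; last first.
      by apply: etrans nc; apply: eq_nochord => x y; rewrite xedge_inl.
    rewrite size_map -map_take lastI -cats1 size_cat addn1 take_size_cat //.
    by rewrite all_map; apply: sub_all pT => v /=; rewrite inE.
  apply/andP; split; last exact: ncxs.
  apply/allP => z; rewrite /xs /= mem_rcons inE => /predU1P[->//|].
  by move=> /mapP[v vp ->] /=; have := allP pA v vp; rewrite inE.
have ux : uniq (xsource V :: xs).
  apply: nochord_uniq pathx ncx _.
  by rewrite /xs mem_rcons inE; apply/negP => /mapP[].
have lx : last (xsource V) xs = xsink V by rewrite last_rcons.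
split; first by rewrite /st_path eqxx pathx lx eqxx.
case=> [|x q] //= sub /and4P[/eqP xE xq /eqP lq uq]; subst x.
congr cons; move: sub; rewrite eqxx => sub.
by apply: nochord_path_eq ncx ux xq sub _; rewrite lq lx.
Qed.

Lemma sure_finish a p :
  a \in addable false -> path (exedge true) a p -> last a p \in addable true ->
  all (fun v => v \notin addable false) p ->
  all (fun v => v \notin addable true) (belast a p) ->
  size p <= 2 ^ k ->
  sure M1 M2 (finish a p)
    (fun q o => correct_outcome M1 M2 S o /\ q <= 2 * (4 * k + 1) * size p).
Proof.
move=> aA ap lT pA pT szp; set y := last a p.
have revE : rev (a :: p) = y :: rev (belast a p) by rewrite lastI rev_rcons.
have ry : path (exedge false) y (rev (belast a p)).
  rewrite (@eq_path _ _ (fun x z => exedge true z x)) ?rev_path // => u v.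
  by rewrite -exedgeN.
have rA : all (fun v => v \notin addable false) (belast y (rev (belast a p))).
  have : all (fun v => v \notin addable false) (rev p) by rewrite all_rev.
  rewrite (_ : rev p = belast y (rev (belast a p))) //.
  by have := revE; rewrite rev_cons [RHS]lastI => /rcons_inj[].
have rsz : size (rev (belast a p)) <= 2 ^ k by rewrite size_rev size_belast.
apply: sure_bind (sure_shortcut ry rsz rA) _ => q Q [yQ lQ subQ ncQ costQ].
have lastQ : last y Q = a.
  rewrite lQ; have := congr1 (last a) revE; rewrite rev_cons last_rcons /=.
  by move=> <-.
set p2 := behead _.
have p2E : rev (y :: Q) = a :: p2.
  by rewrite /p2 lastI lastQ rev_rcons.
have rQ : rev Q = belast a p2.
  by have := p2E; rewrite rev_cons [RHS]lastI => /rcons_inj[].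
have lp2 : last a p2 = y.
  by have := p2E; rewrite rev_cons [RHS]lastI => /rcons_inj[].
have subp2 : subseq (a :: p2) (a :: p).
  by rewrite -p2E -[a :: p]revK revE subseq_rev /= eqxx.
have {}subp2 : subseq p2 p by move: subp2; rewrite /= eqxx.
have ap2 : path (exedge true) a p2.
  have e1 : path (fun x z => exedge false z x) (last y Q) (rev (belast y Q)).
    by rewrite rev_path.
  have -> : p2 = rev (belast y Q) by rewrite /p2 lastI rev_rcons.
  by rewrite -lastQ; apply: sub_path e1 => u v; rewrite -exedgeN.
have p2T : all (fun v => v \notin addable true) (belast a p2).
  rewrite -rQ all_rev; apply/allP => v vQ; apply: (allP pT).
  by rewrite -mem_rev; exact: mem_subseq subQ v vQ.
have p2sz : size p2 <= 2 ^ k := leq_trans (size_subseq subp2) szp.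
apply: sure_bind (sure_shortcut ap2 p2sz p2T) _.
move=> q' Q' [aQ' lQ' subQ' ncQ' costQ'].
split=> /=; last first.
  have szp2 := leq_trans (leq_addr _ _) costQ'.
  have {}szp2 := leq_trans szp2 (leq_mul (leqnn _) (size_subseq subp2)).
  rewrite size_rev size_belast in costQ.
  rewrite addn0 -mulnA mul2n -addnn.
  exact: leq_add (leq_trans (leq_addr _ _) costQ) szp2.
apply: augmenting_path_nochord => //.
- by rewrite lQ' lp2.
- apply/allP => v vQ'; apply: (allP pA); apply: mem_subseq subp2 _ _.
  exact: mem_subseq subQ' _ _.
- apply/allP => v; have : subseq (belast a Q') (belast a p2).
    rewrite -subseq_rev; have : subseq (rev (a :: Q')) (rev (a :: p2)).
      by rewrite subseq_rev /= eqxx.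
    by rewrite !lastI !rev_rcons => /subseq_behead.
  by move=> /mem_subseq/[apply]/(allP p2T).
(* Chords of the second matroid are excluded by the second pass; those of the first by the first
   pass, read backwards and inherited by the subsequence. *)
- rewrite nochord_or ncQ' andTb.
  have : nochord (fun x y => exarc false y x) (a :: p2).
    by rewrite -p2E nochord_rev.
  by apply: (@nochord_subseq V _ (a :: Q')); rewrite /= eqxx.
Qed.

End Correctness.
End Algorithm.

(** * Forward and backward search *)

Section KnownEdges.

Variable V : finType.
Implicit Types (E : seq (V * V)) (A T : {set V}) (x y : V).

Definition linked E x y := connect (known E) x y.

Lemma linkedS E E' x y : {subset E <= E'} -> linked E x y -> linked E' x y.
Proof.
move=> EE'; apply: connect_sub => u v uv.
by apply: connect1; exact: EE'.
Qed.

Lemma linked_edge E x y : (x, y) \in E -> linked E x y.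
Proof. exact: connect1. Qed.

(** What [sure_finish] asks of a path: inner vertices that are neither sources nor sinks, so that
    group testing applies to them. Distinctness bounds the length by [#|V|]. *)
Definition clean_path A T E (ap : V * seq V) :=
  let: (a, p) := ap in
  [&& a \in A, path (known E) a p, last a p \in T, all [predC A] p,
      all [predC T] (belast a p) & uniq (a :: p)].

(** Induction on the length: restart at a later source, or stop at an earlier sink. *)
Lemma clean_path_exists A T E a t :
  a \in A -> t \in T -> linked E a t -> exists ap, clean_path A T E ap.
Proof.
move=> aA tT /connectP[p0 ap0 tE]; rewrite {}tE in tT.
case/shortenP: ap0 tT => p ap up _ lT {p0}.
have [n] := ubnP (size p); elim: n => // n IH in a p aA ap up lT * => szp.
have [/allPn[x xp xA]|pA] := boolP (~~ all [predC A] p).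
  rewrite /= negbK in xA; case/splitPr: xp ap up lT szp => p1 p2.
  rewrite cat_path /= => /and3P[_ _ xp2] up lT szp.
  apply: (IH x p2) => //.
  - exact: subseq_uniq (suffix_subseq (a :: p1) (x :: p2)) up.
  - by move: lT; rewrite last_cat.
  - by move: szp; rewrite size_cat /=; lia.
have [/allPn[x xp xT]|pT] := boolP (~~ all [predC T] (belast a p)).
  rewrite /= negbK in xT; have [ax|ax] := eqVneq x a.
    by exists (a, [::]); rewrite /= aA -ax xT.
  have : x \in a :: belast a p by rewrite inE xp orbT.
  have xp' : x \in p.
    by have := mem_belast xp; rewrite inE (negPf ax).
  have nlast : x != last a p.
    have := up; rewrite lastI rcons_uniq => /andP[lb _].
    by apply: contraNneq lb => <-.
  move=> _; case/splitPr: xp' ap up lT szp nlast pA {xp} => p1 p2.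
  rewrite -cat_rcons cat_path => /andP[ap1 _] up _ szp nlast pA.
  apply: (IH a (rcons p1 x)) => //.
  - exact: subseq_uniq (prefix_subseq (a :: rcons p1 x) p2) up.
  - by rewrite last_rcons.
  - move: szp nlast; rewrite size_cat.
    case: p2 {pA up} => [|y p2] /=; last by lia.
    by rewrite cats0 last_rcons eqxx.
exists (a, p); rewrite /= aA ap lT; move/negbNE: pA => ->.
by move/negbNE: pT => ->.
Qed.

End KnownEdges.

(** * The optimality certificate and the invariants of the two searches *)

Section Phases.

Variables (V : finType) (M1 M2 : matroid V) (S : {set V}) (k : nat).
Hypothesis S_common : common_indep M1 M2 S.
Hypothesis V_small : #|V| <= 2 ^ k.
Local Notation arc := (exarc S M1 M2).
Local Notation bedge := (exedge S M1 M2).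
Local Notation addable := (addable S M1 M2).
Local Notation A := (addable false).
Local Notation T := (addable true).
Local Notation M b := (oracle M1 M2 b).
Implicit Types (F L R U : {set V}) (E : seq (V * V)).

(** Weak duality: [X] is split along [R], the first matroid bounding the part inside and the second
    the part outside. An exchange partner across the cut would be an edge violating closure. *)
Lemma max_common_indepP R :
  (forall v, v \in A -> v \notin R) -> T \subset R ->
  (forall v u, v \in R -> arc false v u -> u \in R) ->
  (forall v u, u \in R -> arc true v u -> v \in R) ->
  max_common_indep M1 M2 S.
Proof.
move=> AR TR R1 R2; split=> // X X_common.
(* If no element of [Z] outside [S] can be added to [S :&: Z], this set spans [Z] in matroid [b]. *)
have rank b (Z : {set V}) :
    (forall v, v \in Z -> v \notin S -> v |: (S :\: ~: Z) \notin indep (M b)) ->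
    #|X :&: Z| <= #|S :&: Z|.
  move=> ZI; rewrite leqNgt; apply/negP => lt.
  have XI : X \in indep (M b) by have /andP[] := X_common; case: b {ZI}.
  have [] := indep_exchange (indep_down (subsetIl S Z) (S_indep S_common b))
    (indep_down (subsetIl X Z) XI) lt.
  move=> x; rewrite !inE => /and3P[xnSZ xX xZ] xI.
  have xS : x \notin S by move: xnSZ; rewrite xZ andbT.
  by have := ZI x xZ xS; rewrite setDE setCK xI.
rewrite -(cardsID R X) -(cardsID R S) !setDE; apply: leq_add.
  apply: (rank false) => v vR vS; apply/negP => vI.
  have vA : v \notin A by apply/negP => /AR; rewrite vR.
  have [u] := indep_exchange_in (S_indep S_common false)
    (notin_addable vS vA) vI.
  rewrite !inE => /andP[uS uR] uI; move: uR; rewrite (R1 v) //.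
  by rewrite /exarc vS uS.
apply: (rank true) => v vR vS; apply/negP => vI.
have vT : v \notin T by apply: contraTN vR => /(subsetP TR); rewrite inE => ->.
have [u] := indep_exchange_in (S_indep S_common true)
  (notin_addable vS vT) vI.
rewrite setCK !inE => /andP[uS uR] uI; move: vR; rewrite inE (R2 v u) //.
by rewrite /exarc vS uS.
Qed.

Definition sound E := forall x y, (x, y) \in E -> bedge true x y.

Lemma sound_path E x p : sound E -> path (known E) x p -> path (bedge true) x p.
Proof. by move=> Es; apply: sub_path => u v; exact: Es. Qed.

Lemma sure_neighbours_set b v U : v \notin S -> v \notin addable b ->
  sure M1 M2 (neighbours S b v k (enum U))
    (fun q l => l = filter (arc b v) (enum U) /\ q <= 1 + 2 * k * size l).
Proof.
move=> vS vb; apply: sure_neighbours => //.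
by apply: leq_trans V_small; rewrite -cardE max_card.
Qed.

Lemma outdegE U v : v \notin S ->
  size (filter (arc true v) (enum U)) = outdeg M2 S U v.
Proof.
by move=> vS; rewrite size_filter; apply: eq_count => u; rewrite /exarc vS.
Qed.

Lemma sure_out_edges U (vs : seq V) :
  {subset vs <= ~: S :\: T} ->
  sure M1 M2 (out_edges S k U vs)
    (fun q E => [/\ sound E,
       forall v u, v \in vs -> u \in U -> arc true v u -> (v, u) \in E &
       forall D, (forall v, v \in vs -> outdeg M2 S U v <= D) ->
         q <= size vs * (1 + 2 * k * D)]).
Proof.
elim: vs => [|v vs IH] vsP /=; first by split.
have := vsP v (mem_head _ _); rewrite in_setD in_setC => /andP[vT vS].
apply: sure_bind (sure_neighbours_set U vS vT) _ => q l [lE qle].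
apply: sure_bind (IH _) _ => [w wvs|q' E [Es Ec Eq] /=].
  by apply: vsP; rewrite inE wvs orbT.
split.
- move=> x y; rewrite mem_cat => /orP[/mapP[u]|]; last exact: Es.
  by rewrite lE mem_filter => /andP[vu _] [-> ->]; rewrite /exedge vu.
- move=> w u; rewrite inE mem_cat => /predU1P[-> uU vu|wvs uU wu].
    by apply/orP; left; apply: map_f; rewrite lE mem_filter vu mem_enum.
  by rewrite (Ec w u) ?orbT.
- move=> D Dle; rewrite addn0 mulSn leq_add //.
    apply: leq_trans qle _; rewrite lE outdegE // leq_add2l leq_mul2l.
    by rewrite Dle ?orbT ?mem_head.
  by apply: Eq => w wvs; apply: Dle; rewrite inE wvs orbT.
Qed.

(** Closure concerns only the edges into [S]; those leaving [S] are not followed. It lets later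
    searches restrict their targets to [S :\: F]. *)
Record visited F E : Prop := Visited {
  visited_sound : sound E;
  visited_linked : forall x, x \in F -> exists2 a, a \in A & linked E a x;
  visited_closed : forall v u, v \in F -> arc true v u -> u \in F
}.

Lemma sure_visit F E (vs : seq V) : visited F E -> {subset vs <= ~: S :\: T} ->
  (forall v, v \in vs -> exists2 a, a \in A & linked E a v) ->
  sure M1 M2 (visit S k F E vs)
    (fun q FE => [/\ visited FE.1 FE.2, F \subset FE.1, {subset vs <= FE.1},
       {subset E <= FE.2} &
       q + 2 * k * #|S :\: FE.1| <= size vs + 2 * k * #|S :\: F|]).
Proof.
elim: vs F E => [|v vs IH] F E [Es El Ec] vsP vsl /=; first by split.
have := vsP v (mem_head _ _); rewrite in_setD in_setC => /andP[vT vS].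
apply: sure_bind (sure_neighbours_set _ vS vT) _ => q l [lE qle].
set F1 := _ :|: _; set E1 := _ ++ E.
have EE1 : {subset E <= E1} by move=> e eE; rewrite mem_cat eE orbT.
have FF1 : F \subset F1.
  by apply/subsetP => x xF; rewrite !inE xF orbT.
have arcl u : u \in l -> arc true v u by rewrite lE mem_filter => /andP[].
have vE1 u : u \in l -> (v, u) \in E1.
  by move=> ul; rewrite mem_cat map_f.
have [a0 a0A a0v] := vsl v (mem_head _ _).
have vis1 : visited F1 E1.
  split.
  - move=> x y; rewrite mem_cat => /orP[/mapP[u]|]; last exact: Es.
    by move=> /arcl vu [-> ->]; rewrite /exedge vu.
  - move=> x; rewrite !inE => /orP[/predU1P[->|/El[a aA ax]]|xl].
    + by exists a0 => //; exact: linkedS EE1 a0v.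
    + by exists a => //; exact: linkedS EE1 ax.
    + exists a0 => //; apply: connect_trans (linkedS EE1 a0v) _.
      by apply: linked_edge; exact: vE1.
  - move=> x u; rewrite !inE => /orP[/predU1P[->|xF]|/arcl]; last first.
    + by move=> /and3P[_ xS _] /and3P[]; rewrite xS.
    + by move=> /(Ec _ _ xF) ->; rewrite orbT.
    + move=> vu; rewrite lE mem_filter vu mem_enum !inE.
      by have /and3P[_ -> _] := vu; case: (u \in F); rewrite ?orbT.
have vsP1 : {subset vs <= ~: S :\: T}.
  by move=> w wvs; apply: vsP; rewrite inE wvs orbT.
apply: sure_imp (IH F1 E1 vis1 vsP1 _) _.
  move=> w wvs; have [|a aA aw] := vsl w; first by rewrite inE wvs orbT.
  by exists a => //; exact: linkedS EE1 aw.
move=> q' [F' E'] /= [vis' F1F' vsF' E1E' cost]; split=> //.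
- exact: subset_trans F1F'.
- move=> w; rewrite inE => /predU1P[->|/vsF' //].
  by apply: (subsetP F1F'); rewrite !inE eqxx.
- by move=> e /EE1/E1E'.
- have : #|S :\: F1| + size l <= #|S :\: F|.
    apply: leq_card_setDU => //; first by rewrite lE filter_uniq ?enum_uniq.
      by move=> u; rewrite lE mem_filter mem_enum => /andP[].
    by move=> u ul; rewrite !inE ul orbT.
  clear -qle cost; set c1 := #|_|; set c := #|_| => cl.
  have := leq_mul (leqnn (2 * k)) cl; rewrite mulnDr; lia.
Qed.

Record co_visited (Lt Z R : {set V}) E (todo : seq V) : Prop := CoVisited {
  co_visited_sound : sound E;
  co_visited_linked : forall x, x \in R -> exists2 z, z \in Z & linked E x z;
  co_visited_arc : forall v u, v \in R -> v \notin todo -> arc false v u ->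
    u \in R;
  co_visited_light : forall w u, u \in R -> w \in Lt -> u \in S ->
    (w, u) \in E -> w \in R
}.

Lemma sure_reverse_search (Lt Z R : {set V}) E (todo : seq V) fuel :
  Lt \subset ~: S :\: A -> {subset todo <= ~: S :\: A} -> {subset todo <= R} ->
  co_visited Lt Z R E todo -> size todo + #|~: S :\: R| <= fuel ->
  sure M1 M2 (reverse_search S k Lt fuel R E todo)
    (fun q E' => {subset E <= E'} /\ q <= fuel + 2 * k * #|S :\: R| /\
       exists2 R' : {set V}, R \subset R' & co_visited Lt Z R' E' [::]).
Proof.
move=> LtP.
elim: fuel R E todo => [|fuel IH] R E [|v todo] todoP todoR covis szf.
- by split=> //; split=> //; exists R.
- by rewrite /= addSn in szf.
- by split=> //; split=> //; exists R.
have [Es El Ea Elt] := covis.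
have := todoP v (mem_head _ _); rewrite in_setD in_setC => /andP[vA vS] /=.
apply: sure_bind (sure_neighbours_set _ vS vA) _ => q l [lE qle].
set R1 := R :|: _; set ws := filter _ _; set R2 := R1 :|: _; set E1 := _ ++ E.
have EE1 : {subset E <= E1} by move=> e eE; rewrite mem_cat eE orbT.
have arcl u : u \in l -> arc false v u by rewrite lE mem_filter => /andP[].
have lS u : u \in l -> u \in S by move=> /arcl/and3P[].
have vE1 u : u \in l -> (u, v) \in E1.
  by move=> ul; rewrite mem_cat (map_f (fun u => (u, v))).
have wsLt w : w \in ws -> w \in Lt :\: R1.
  by rewrite mem_filter mem_enum => /andP[].
have wsP w : w \in ws -> w \in ~: S :\: A.
  by move=> /wsLt; rewrite inE => /andP[_]; exact: (subsetP LtP).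
have RR2 : R \subset R2.
  by apply/subsetP => x xR; rewrite !inE xR.
have lR2 u : u \in l -> u \in R2 by move=> ul; rewrite !inE ul orbT.
have wsR2 w : w \in ws -> w \in R2 by move=> wl; rewrite !inE wl !orbT.
have R2P x : x \in R2 -> [\/ x \in R, x \in l | x \in ws].
  rewrite !inE => /orP[/orP[]|] ?;
    by [constructor 1|constructor 2|constructor 3].
have [z0 z0Z vz0] := El v (todoR v (mem_head _ _)).
have linkl u : u \in l -> exists2 z, z \in Z & linked E1 u z.
  move=> ul; exists z0 => //; apply: connect_trans (linkedS EE1 vz0).
  by apply: linked_edge; exact: vE1.
have covis2 : co_visited Lt Z R2 E1 (todo ++ ws).
  split.
  - move=> x y; rewrite mem_cat => /orP[/mapP[u]|]; last exact: Es.
    by move=> /arcl vu [-> ->]; rewrite /exedge vu orbT.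
  - move=> x /R2P[xR|xl|xws].
    + by have [z zZ xz] := El x xR; exists z => //; exact: linkedS EE1 xz.
    + exact: linkl.
    + move: xws; rewrite mem_filter => /andP[/= /hasP[u ul xu] _].
      have [z zZ uz] := linkl u ul; exists z => //.
      by apply: connect_trans uz; apply: linked_edge; exact: EE1.
  - move=> x u /R2P[xR|/lS xS|xws]; rewrite mem_cat negb_or => /andP[xt xw] xu.
    + have [xv|xv] := eqVneq x v; last first.
        apply: (subsetP RR2); apply: Ea xR _ xu.
        by rewrite inE negb_or xv.
      subst x; have [uR|uR] := boolP (u \in R); first exact: (subsetP RR2).
      apply: lR2; rewrite lE mem_filter xu mem_enum !inE uR.
      by have /and3P[] := xu.
    + by have /and3P[] := xu; rewrite xS.
    + by rewrite xws in xw.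
  - move=> w u uR2 wLt uS; rewrite mem_cat => /orP[/mapP[u' /lS u'S [wE _]]|wu].
      move: u'S; rewrite -wE => wS.
      by have := subsetP LtP w wLt; rewrite !inE wS andbF.
    have [wR1|wR1] := boolP (w \in R1); first by rewrite inE wR1.
    case/R2P: uR2 => [uR|ul|uws].
    + by apply: (subsetP RR2); exact: Elt wu.
    + apply: wsR2; rewrite mem_filter mem_enum in_setD wR1 wLt /= andbT.
      by apply/hasP; exists u.
    + by have := wsP u uws; rewrite !inE uS andbF.
have szf2 : size (todo ++ ws) + #|~: S :\: R2| <= fuel.
  have : #|~: S :\: R2| + size ws <= #|~: S :\: R|.
    apply: leq_card_setDU => //; first by rewrite filter_uniq ?enum_uniq.
    move=> w wws; have := wsP w wws; have := wsLt w wws.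
    by rewrite !inE negb_or => /andP[/andP[-> _] _] /andP[_ ->].
  by move: szf; rewrite size_cat /=; clear; lia.
have todoP2 : {subset todo ++ ws <= ~: S :\: A}.
  move=> w; rewrite mem_cat => /orP[wt|/wsP //].
  by apply: todoP; rewrite inE wt orbT.
have todoR2 : {subset todo ++ ws <= R2}.
  move=> w; rewrite mem_cat => /orP[wt|/wsR2 //].
  by apply: (subsetP RR2); apply: todoR; rewrite inE wt orbT.
apply: sure_imp (IH _ _ _ todoP2 todoR2 covis2 szf2) _.
move=> q' E' [E1E' [cost [R' R2R' covis']]]; split; last split.
- by move=> e /EE1/E1E'.
- have : #|S :\: R2| + size l <= #|S :\: R|.
    apply: leq_card_setDU => //; first by rewrite lE filter_uniq ?enum_uniq.
    by move=> u; rewrite lE mem_filter mem_enum => /andP[].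
  clear -qle cost; set c1 := #|_|; set c := #|_| => cl.
  have := leq_mul (leqnn (2 * k)) cl; rewrite mulnDr; lia.
- by exists R' => //; exact: subset_trans R2R'.
Qed.

End Phases.

(* The case distinction on [clean_path] takes no query: it depends on the     *)
(* known edges [E2] only.                                                     *)
Definition phase (V : finType) (S : {set V}) (k : nat) (A T F L : {set V})
    (E : seq (V * V)) (H : seq V) :
    oracle_alg V (outcome V + {set V} * {set V} * seq (V * V)) :=
  let cand := enum (~: S :\: (F :|: L :|: T)) in
  let light := [seq v <- cand | v \notin H] in
  let Lt := L :|: [set v in light] in
  let heavy := [set v in cand | v \in H] in
  let! E1 := out_edges S k (S :\: F) light in
  let! E2 := reverse_search S k (Lt :\: F) #|V| (heavy :|: T) (E1 ++ E)
               (enum (heavy :|: T)) in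
  match pselect (exists ap, clean_path A T E2 ap) with
  | left ex_path =>
      let ap := sval (cid ex_path) in
      let! o := finish S k ap.1 ap.2 in Return V (inl o)
  | right _ =>
      let X := [set v in ~: S :\: F | [exists a in A, linked E2 a v]] in
      if X :&: heavy == set0 then Return V (inl (IsMaximum V)) else
      let! FE := visit S k F E2 (enum X) in
      Return V (inr (FE.1, Lt, FE.2))
  end.

(** The answer without fuel is a default that is never reached: each phase that does not stop
    enlarges [F], and [sure_search] starts with more fuel than vertices outside [F]. *)
Fixpoint search (V : finType) (S : {set V}) (k K m : nat) (A T : {set V})
    (fuel : nat) (F L : {set V}) (E : seq (V * V)) : oracle_alg V (outcome V) :=
  if fuel is fuel'.+1 then
    let! H := classify S K m (S :\: F) (enum (~: S :\: (F :|: L :|: T))) in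
    let! r := phase S k A T F L E H in
    match r with
    | inl o => Return V o
    | inr (F', L', E') => search S k K m A T fuel' F' L' E'
    end
  else Return V (IsMaximum V).

(** A vertex that is both source and sink gives a path at once; otherwise sources and sinks are
    disjoint, so the out-edges of sources and the in-edges of sinks can be found by group
    testing. *)
Definition augment (V : finType) (S : {set V}) (k K m : nat) :
    oracle_alg V (outcome V) :=
  let! lA := addable_among S false (enum (~: S)) in
  let! lT := addable_among S true (enum (~: S)) in
  let A := [set v in lA] in
  let T := [set v in lT] in
  if [pick a in A :&: T] is Some a then finish S k a [::] else
  let! FE := visit S k set0 [::] (enum A) in
  search S k K m A T #|V|.+1 FE.1 set0 FE.2.

(** * Progress and amortized cost of the phases *)

Section Search.

Variables (V : finType) (M1 M2 : matroid V) (S : {set V}) (k : nat).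
Hypothesis S_common : common_indep M1 M2 S.
Hypothesis V_small : #|V| <= 2 ^ k.
Local Notation arc := (exarc S M1 M2).
Local Notation A := (addable S M1 M2 false).
Local Notation T := (addable S M1 M2 true).
Implicit Types (F L R U : {set V}) (E : seq (V * V)).

(** As [F] only grows, the edges listed for a light vertex remain complete towards the elements
    outside [F]. *)
Record state_ok F L E : Prop := StateOk {
  state_visited : visited M1 M2 S F E;
  state_sources : A \subset F;
  state_light : L \subset ~: S;
  state_known : forall v u, v \in L -> u \notin F -> arc true v u ->
    (v, u) \in E
}.

(** The reverse search costs at most n + 2kn and [finish] at most 2(4k + 1)n; a visit costs less
    than [finish]. *)
Definition phase_cost := 3 * #|V| + 10 * k * #|V|.

(** [H] is arbitrary: a wrong classification affects neither correctness nor termination, only the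
    bound [D] on the light out-degrees and the size of the gain at [h]. *)
Lemma sure_phase F L E (H : seq V) : [disjoint A & T] -> state_ok F L E ->
  let light := [seq v <- enum (~: S :\: (F :|: L :|: T)) | v \notin H] in
  sure M1 M2 (phase S k A T F L E H) (fun q r =>
    (forall D, (forall v, v \in light -> outdeg M2 S (S :\: F) v <= D) ->
       q <= size light * (1 + 2 * k * D) + phase_cost) /\
    match r with
    | inl o => correct_outcome M1 M2 S o
    | inr (F', L', E') =>
        [/\ state_ok F' L' E', #|~: F'| < #|~: F|,
            #|~: L'| + size light <= #|~: L| &
            exists2 h, h \in H &
              #|S :\: F'| + outdeg M2 S (S :\: F) h <= #|S :\: F|]
    end).
Proof.
move=> AT [[Es El Ec] AF LS Lk] light.
rewrite /phase; set cand := enum _ in light *.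
rewrite -/light; set Lt := L :|: _; set heavy := [set v in cand | _].
have candP v : v \in cand ->
    [/\ v \notin S, v \notin F, v \notin L & v \notin T].
  by rewrite mem_enum in_setD in_setC !in_setU !negb_or
    => /andP[/andP[/andP[-> ->] ->] ->].
have lightP v : v \in light -> v \in cand /\ v \notin H.
  by rewrite mem_filter => /andP[].
have heavyP v : v \in heavy -> v \in cand /\ v \in H.
  by rewrite inE => /andP[].
have lightT : {subset light <= ~: S :\: T}.
  by move=> v /lightP[/candP[vS _ _ vT] _]; rewrite in_setD in_setC vS vT.
have LtS v : v \in Lt -> v \notin S.
  rewrite in_setU in_set => /orP[/(subsetP LS)|/lightP[/candP[] //]].
  by rewrite in_setC.
apply: sure_bind (sure_out_edges S_common V_small _ lightT) _.
move=> q1 E1 [E1s E1c cost1].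
set E1E := E1 ++ E; set R0 := heavy :|: T.
have R0P v : v \in R0 -> v \in ~: S :\: A.
  rewrite in_setU in_setD in_setC => /orP[/heavyP[/candP[-> vF _ _] _]|vT].
    by rewrite andbT; apply: contra vF; exact: (subsetP AF).
  by rewrite (disjointFl AT vT) /=; move: vT; rewrite inE => /andP[].
have LtP : Lt :\: F \subset ~: S :\: A.
  apply/subsetP => v; rewrite !in_setD in_setC => /andP[vF /LtS ->].
  by rewrite andbT; apply: contra vF; exact: (subsetP AF).
have E1Es : sound M1 M2 S E1E.
  by move=> x y; rewrite mem_cat => /orP[]; [exact: E1s|exact: Es].
have Ltk v u : v \in Lt -> u \notin F -> arc true v u -> (v, u) \in E1E.
  rewrite in_setU in_set mem_cat => /orP[vL uF vu|vl uF vu].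
    by rewrite (Lk v u) ?orbT.
  by rewrite (E1c v u) // in_setD uF; have /and3P[] := vu.
have covis : co_visited M1 M2 S (Lt :\: F) R0 R0 E1E (enum R0).
  split=> //.
  - by move=> x xR; exists x => //; exact: connect0.
  - by move=> v u vR; rewrite mem_enum vR.
  - by move=> w u /R0P; rewrite in_setD in_setC => /andP[_ /negPf ->].
have fuelP : size (enum R0) + #|~: S :\: R0| <= #|V|.
  rewrite -cardE -cardsUI; have -> : R0 :&: (~: S :\: R0) = set0.
    by apply/setP => x; rewrite !in_setI !in_setD in_set0; case: (x \in R0).
  by rewrite cards0 addn0 max_card.
have todoR : {subset enum R0 <= R0} by move=> x; rewrite mem_enum.
have todoP : {subset enum R0 <= ~: S :\: A} by move=> x /todoR/R0P.
have rs := sure_reverse_search S_common V_small LtP todoP todoR covis fuelP.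
apply: sure_bind rs _.
move=> q2 E2 [E12 [cost2 [R RR0 [E2s Rl Ra Rlt]]]].
have EE2 : {subset E <= E2}.
  by move=> e eE; apply: E12; rewrite mem_cat eE orbT.
have leV (B : {set V}) : 2 * k * #|B| <= 2 * k * #|V|.
  by rewrite leq_mul2l max_card orbT.
case: pselect => [ex_path|no_path].
  case: cid => -[a p] /= /and5P[aA ap lT pA /andP[pT up]].
  have szp : size p <= #|V|.
    have /card_uniqP sz : uniq (a :: p) := up.
    by apply: ltnW; rewrite -[_.+1]/(size (a :: p)) -sz max_card.
  apply: sure_bind (sure_finish S_common aA (sound_path E2s ap) lT pA pT
    (leq_trans szp V_small)) _ => q3 o [o_ok cost3] /=.
  split=> // D /cost1 {}cost1.
  have := leq_trans cost3 (leq_mul (leqnn _) szp).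
  have := leV (S :\: R0); rewrite /phase_cost.
  by move: cost1 cost2; clear; set z := size light * _; lia.
set X := [set v in _ | _].
have XP v : v \in X -> [/\ v \notin S, v \notin F &
    exists2 a, a \in A & linked E2 a v].
  rewrite in_set in_setD in_setC => /andP[/andP[-> ->]].
  by move=> /existsP[a /andP[aA av]]; split=> //; exists a.
have linkT v a : a \in A -> linked E2 a v -> v \notin T.
  move=> aA av; apply/negP => vT; apply: no_path.
  exact: clean_path_exists aA vT av.
case: ifPn => [/eqP Xh|/set0Pn[h /setIP[hX hh]]].
  split=> [D /cost1 {}cost1|].
    rewrite addn0; have := leV (S :\: R0); rewrite /phase_cost.
    by move: cost1 cost2; clear; set z := size light * _; lia.
  (* A visited vertex that reaches a sink would give a path, and one that reaches a heavy vertex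
     would put it into [X]. *)
  have FR x : x \in F -> x \notin R.
    move=> xF; apply/negP => /Rl[z zR0 xz]; have [a aA ax] := El x xF.
    have az : linked E2 a z := connect_trans (linkedS EE2 ax) xz.
    move: zR0; rewrite in_setU (negPf (linkT _ _ aA az)) orbF => zh.
    suff : z \in X :&: heavy by rewrite Xh in_set0.
    rewrite in_setI zh andbT in_set in_setD in_setC.
    have [/candP[-> -> _ _] _] := heavyP z zh.
    by apply/existsP; exists a; rewrite aA.
  apply: (@max_common_indepP _ M1 M2 S S_common R).
  - by move=> v /(subsetP AF)/FR.
  - by apply: subset_trans RR0; exact: subsetUr.
  - by move=> v u vR; exact: Ra.
  (* Here [v] is outside [F], since [F] is closed; so it is a sink, heavy or light. In the last case
     its edge to [u] is known and the reverse search has followed it. *)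
  - move=> v u uR vu; have uF : u \notin F by apply: contraTN uR; exact: FR.
    have [vR0|vR0] := boolP (v \in R0); first exact: (subsetP RR0).
    have vF : v \notin F by apply: contra uF => vF; exact: Ec vu.
    have [vS uS _] := and3P vu.
    have vLt : v \in Lt.
      move: vR0; rewrite !in_setU !in_set negb_or => /andP[vh vT].
      have [//|vL] := boolP (v \in L).
      rewrite mem_filter /=.
      have vc : v \in cand.
        by rewrite mem_enum in_setD in_setC !in_setU !negb_or vF vL vS inE vT.
      by rewrite vc andbT; move: vh; rewrite vc.
    by apply: Rlt uR _ uS (E12 _ (Ltk _ _ vLt uF vu)); rewrite in_setD vF.
have vis : visited M1 M2 S F E2.
  split=> // x xF; have [a aA ax] := El x xF.
  by exists a => //; exact: linkedS EE2 ax.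
have XT : {subset enum X <= ~: S :\: T}.
  move=> v; rewrite mem_enum => /XP[vS _ [a aA av]].
  by rewrite in_setD in_setC vS (linkT _ _ aA av).
have Xl v : v \in enum X -> exists2 a, a \in A & linked E2 a v.
  by rewrite mem_enum => /XP[].
apply: sure_bind (sure_visit S_common V_small vis XT Xl) _.
move=> q3 [F' E3] /= [vis' FF' XF' E23 cost3].
have hF' : h \in F' by apply: XF'; rewrite mem_enum.
have [hS hF _] := XP h hX.
split=> [D /cost1 {}cost1|].
  rewrite addn0 /phase_cost; have := leV (S :\: R0); have := leV (S :\: F).
  have := leq_trans (leq_addr _ _) cost3.
  have : size (enum X) <= #|V| by rewrite -cardE max_card.
  by move: cost1 cost2; clear; set z := size light * _; lia.
split.
- split=> //; first exact: subset_trans AF FF'.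
    by apply/subsetP => v /LtS; rewrite in_setC.
  move=> v u vL uF' vu; apply/E23/E12; apply: Ltk => //.
  by apply: contra uF'; exact: (subsetP FF').
- apply: proper_card; rewrite properE setCS FF' /=.
  by apply/subsetPn; exists h; rewrite ?in_setC ?hF // negbK.
- have light_uniq : uniq light by rewrite filter_uniq // enum_uniq.
  rewrite -!setTD; apply: leq_card_setDU => //; last 2 first.
  + exact: subsetUl.
  + by move=> v vl; rewrite in_setU in_set vl orbT.
  + by move=> v /lightP[/candP[_ _ vL _] _]; rewrite in_setD vL in_setT.
- exists h; first by have [] := heavyP h hh.
  rewrite -(outdegE M1) //; apply: leq_card_setDU => //.
  + by rewrite filter_uniq // enum_uniq.
  + by move=> u; rewrite mem_filter mem_enum => /andP[].
  + move=> u; rewrite mem_filter => /andP[hu _].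
    by case: vis' => _ _; apply; first exact: hF'.
Qed.

Lemma sure_search K m fuel F L E : [disjoint A & T] -> state_ok F L E ->
  #|~: F| < fuel ->
  sure M1 M2 (search S k K m A T fuel F L E)
    (fun _ o => correct_outcome M1 M2 S o).
Proof.
move=> AT; elim: fuel F L E => [|fuel IH] F L E // st lt.
apply: sure_bind (sure_True _ _ _) _ => q H _.
apply: sure_bind (sure_phase H AT st) _ => q' [o|[[F' L'] E']] [_] //.
by move=> [st' lt' _ _]; apply: IH st' _; exact: leq_trans lt' lt.
Qed.

(** Bounds K+1 times the number of queries, to avoid division. With [s] elements of [S] unvisited
    there are at most 1 + 8s/(K+1) phases; each of the [l] vertices not yet light pays once for at
    most 3(K+1) edges. *)
Definition search_cost K m (s l : nat) :=
  (phase_cost + #|V| * m.*2) * (K.+1 + 8 * s) +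
  K.+1 * (1 + 2 * k * (3 * K.+1)) * l.

Lemma search_cost_stop K m s l l' q q' :
  q <= #|V| * m.*2 -> q' <= l' * (1 + 2 * k * (3 * K.+1)) + phase_cost ->
  l' <= l -> K.+1 * (q + q') <= search_cost K m s l.
Proof.
rewrite /search_cost; set D := 1 + _; set p := phase_cost; set n := _ * m.*2.
move=> qn q'n l'l; apply: (@leq_trans (K.+1 * (p + n + D * l'))).
  by rewrite leq_pmul2l //; move: qn q'n; rewrite mulnC; clear; lia.
rewrite mulnDr mulnA leq_add ?leq_mul2l ?l'l ?orbT //.
by rewrite mulnC leq_mul2l leq_addr orbT.
Qed.

Lemma search_cost_step K m s s' l l' lt q q' q'' :
  q <= #|V| * m.*2 -> q' <= lt * (1 + 2 * k * (3 * K.+1)) + phase_cost ->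
  l' + lt <= l -> K.+1 + 8 * s' <= 8 * s ->
  K.+1 * q'' <= search_cost K m s' l' ->
  K.+1 * (q + q' + q'') <= search_cost K m s l.
Proof.
rewrite /search_cost; set D := 1 + _; set p := phase_cost; set n := _ * m.*2.
move=> qn q'n ll ss q''n; rewrite mulnDr.
apply: leq_trans (leq_add (n1 := K.+1 * (p + n + D * lt)) _ q''n) _.
  by rewrite leq_pmul2l //; move: qn q'n; rewrite mulnC; clear; lia.
have := leq_mul (leqnn (p + n)) ss; have := leq_mul (leqnn (K.+1 * D)) ll.
by move: (p + n) K.+1 => P a; clear; lia.
Qed.

(** Classification is the only step that may fail, with probability at most n 2^-m in each of at
    most [fuel] phases. *)
Lemma whp_search (R : realType) K m fuel F L E :
  [disjoint A & T] -> state_ok F L E ->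
  whp M1 M2 (fuel%:R * (#|V|%:R * 2 ^- m) : R)%R
    (search S k K m A T fuel F L E)
    (fun q _ => K.+1 * q <= search_cost K m #|S :\: F| #|~: L|).
Proof.
move=> AT; elim: fuel F L E => [|fuel IH] F L E // st.
  by apply: whp_sure; rewrite ?mul0r //= muln0.
have d0 : (0 <= #|V|%:R * 2 ^- m :> R)%R.
  by rewrite mulr_ge0 // invr_ge0 exprn_ge0.
set d := (#|V|%:R * 2 ^- m)%R in IH d0 *.
have -> : (fuel.+1%:R * d = d + fuel%:R * d)%R.
  by rewrite -natr1 mulrDl mul1r addrC.
rewrite /=; set cand := enum _.
have candT v : v \in cand -> v |: S \notin indep M2.
  rewrite mem_enum in_setD in_setC !in_setU !negb_or.
  by move=> /andP[/andP[_ vT] vS]; exact: notin_addable vT.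
have cl : whp M1 M2 d (classify S K m (S :\: F) cand)
    (fun q H => [/\ q <= #|V| * m.*2,
       forall v, v \in H -> K.+1 < 8 * outdeg M2 S (S :\: F) v &
       forall v, v \in cand -> v \notin H ->
         outdeg M2 S (S :\: F) v < 3 * K.+1]).
  have szc : size cand <= #|V| by rewrite -cardE max_card.
  have := whp_classify R M1 (S_indep S_common true) K m (S :\: F) candT.
  rewrite /whp => h; apply: le_trans (le_trans h _).
    by rewrite lerD2l lerN2 ler_wpM2r ?invr_ge0 ?exprn_ge0 // ler_nat.
  apply: prob_le => q H [qle Hh Hl]; split=> //.
  by apply: leq_trans qle _; rewrite leq_mul2r szc orbT.
apply: whp_bind cl _; first by rewrite mulr_ge0.
move=> q H [qle Hh Hl]; rewrite -[X in whp _ _ X]add0r.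
apply: whp_bind (whp_sure _ (sure_phase H AT st)) _ => //.
  by rewrite mulr_ge0.
set light := [seq v <- _ | _].
move=> q' r [/(_ (3 * K.+1)) cost].
have {}cost : q' <= size light * (1 + 2 * k * (3 * K.+1)) + phase_cost.
  apply: cost => v; rewrite mem_filter => /andP[vH vc].
  by apply: ltnW; exact: Hl.
have K0 : 0 < K.+1 by [].
case: r => [o _|[[F' L'] E'] [st' _ lL [h hH hs]]].
  apply: whp_sure; first by rewrite mulr_ge0.
  rewrite /= addn0.
  have : size light <= #|~: L|.
    rewrite -(card_uniqP _); last by rewrite filter_uniq // enum_uniq.
    apply: subset_leq_card; apply/subsetP => v; rewrite mem_filter mem_enum.
    rewrite in_setD !in_setU !negb_or => /andP[_ /andP[/andP[/andP[_ vL] _] _]].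
    by rewrite in_setC.
  exact: search_cost_stop qle cost.
apply: whp_imp (IH _ _ _ st') _ => q'' _ cost''.
have {}hs : K.+1 + 8 * #|S :\: F'| <= 8 * #|S :\: F|.
  by have := Hh h hH; move: hs; clear; lia.
rewrite addnA; exact: search_cost_step qle cost lL hs cost''.
Qed.

End Search.

(** * Cost of the whole algorithm *)

Section Augment.

Variables (V : finType) (M1 M2 : matroid V) (S : {set V}) (k : nat).
Hypothesis S_common : common_indep M1 M2 S.
Hypothesis V_small : #|V| <= 2 ^ k.
Local Notation A := (addable S M1 M2 false).
Local Notation T := (addable S M1 M2 true).

Lemma sure_addable b :
  sure M1 M2 (addable_among S b (enum (~: S)))
    (fun q l => q <= #|V| /\ [set v in l] = addable S M1 M2 b).
Proof.
have sub : {subset enum (~: S) <= ~: S} by move=> v; rewrite mem_enum.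
apply: sure_imp (sure_addable_among M1 M2 b sub) _ => q l [-> ->].
split; first by rewrite -cardE max_card.
apply/setP => v; rewrite in_set mem_filter mem_enum in_setC inE.
by rewrite inE; case: (v \in S) => //=; rewrite andbT.
Qed.

Lemma sure_visit_sources : [disjoint A & T] ->
  sure M1 M2 (visit S k set0 [::] (enum A))
    (fun q FE => state_ok M1 M2 S FE.1 set0 FE.2 /\
       q <= #|V| + 2 * k * #|V|).
Proof.
move=> AT.
have AP : {subset enum A <= ~: S :\: T}.
  move=> v; rewrite mem_enum => vA.
  rewrite in_setD in_setC (disjointFr AT vA).
  by move: vA; rewrite inE => /andP[].
have vis : visited M1 M2 S set0 [::].
  by split=> // [x|v u]; rewrite in_set0.
have Al v : v \in enum A -> exists2 a, a \in A & linked [::] a v.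
  by rewrite mem_enum => vA; exists v => //; exact: connect0.
apply: sure_imp (sure_visit S_common V_small vis AP Al) _.
move=> q [F E] /= [vis' _ AF _ cost]; split.
  split=> //; last by move=> v u; rewrite in_set0.
    by apply/subsetP => v vA; apply: AF; rewrite mem_enum.
  exact: sub0set.
apply: leq_trans (leq_trans (leq_addr _ _) cost) _.
by rewrite -cardE leq_add ?max_card // leq_mul2l max_card orbT.
Qed.

Lemma sure_finish_single a : a \in A :&: T ->
  sure M1 M2 (finish S k a [::])
    (fun q o => correct_outcome M1 M2 S o /\ q = 0).
Proof.
rewrite in_setI => /andP[aA aT].
have := @sure_finish V S k M1 M2 S_common a [::] aA isT aT isT isT (leq0n _).
move=> /sure_imp; apply => q o [o_ok].
by rewrite muln0 leqn0 => /eqP.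
Qed.

Lemma sure_augment K m :
  sure M1 M2 (augment S k K m) (fun _ o => correct_outcome M1 M2 S o).
Proof.
apply: sure_bind (sure_addable false) _ => q1 lA [_ AE].
apply: sure_bind (sure_addable true) _ => q2 lT [_ TE] /=.
rewrite AE TE; case: pickP => [a aAT|AT].
  by apply: sure_imp (sure_finish_single aAT) _ => q o [].
have {}AT : [disjoint A & T].
  by rewrite -setI_eq0; apply/eqP/setP => v; rewrite in_set0; exact: AT.
apply: sure_bind (sure_visit_sources AT) _ => q3 FE [st _].
apply: (@sure_search _ _ _ _ _ S_common V_small _ _ #|V|.+1) => //.
by rewrite ltnS max_card.
Qed.

Lemma search_cost_le K s l q : s <= K.+1 ^ 2 -> l <= #|V| -> 0 < k ->
  forall c, K.+1 * q <= search_cost V k K (c * k) s l ->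
  q <= (124 + 18 * c) * (#|V| * k * K.+1).
Proof.
rewrite /search_cost /phase_cost; move: #|V| => n.
move=> sK ln k0 c H; rewrite -(leq_pmul2l (ltn0Sn K)); apply: leq_trans H _.
move: K.+1 (ltn0Sn K) sK => a a0 sK.
have e1 : n <= n * k by rewrite leq_pmulr.
have e2 : a + 8 * s <= 9 * (a * a).
  by have := leq_pmull a a0; move: sK; rewrite -mulnn; clear; lia.
have -> : 3 * n + 10 * k * n + n * (c * k).*2 = 3 * n + (10 + 2 * c) * (n * k).
  by rewrite -mul2n; ring.
(* With a = K+1, the factors 13 + 2c and 9 come from n <= nk and s <= a^2, and 7 from 1 + 6ka <=
   7ka. In all 13 * 9 + 7 = 124. *)
apply: (@leq_trans ((13 + 2 * c) * (n * k) * (9 * (a * a)) +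
                    a * (7 * (k * a)) * n)); last first.
  by rewrite eq_leq //; ring.
apply: leq_add.
  by apply: leq_mul => //; move: e1; clear; lia.
apply: leq_mul => //; rewrite leq_mul2l; apply/orP; right.
have : 1 <= k * a by rewrite muln_gt0 k0.
by clear; lia.
Qed.

Lemma whp_augment (R : realType) K c : #|S| <= K.+1 ^ 2 -> 0 < k ->
  whp M1 M2 (#|V|.+1%:R * (#|V|%:R * 2 ^- (c * k)) : R)%R
    (augment S k K (c * k))
    (fun q _ => q <= (129 + 18 * c) * (#|V| * k * K.+1)).
Proof.
move=> SK k0.
have d0 : (0 <= #|V|.+1%:R * (#|V|%:R * 2 ^- (c * k)) :> R)%R.
  by rewrite !mulr_ge0 // invr_ge0 exprn_ge0.
rewrite -[X in whp _ _ X]add0r.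
apply: whp_bind (whp_sure _ (sure_addable false)) _ => //.
move=> q1 lA [q1le AE]; rewrite -[X in whp _ _ X]add0r.
apply: whp_bind (whp_sure _ (sure_addable true)) _ => //.
move=> q2 lT [q2le TE] /=; rewrite AE TE.
have nk : #|V| <= #|V| * k * K.+1.
  by rewrite -mulnA leq_pmulr // muln_gt0 k0.
(* The extra 5 pays for the two scans for sources and sinks, n each, and for visiting the sources, n
   + 2kn. *)
have splitc : 129 + 18 * c = 5 + (124 + 18 * c) by [].
case: pickP => [a aAT|AT].
  apply: whp_sure => //; apply: sure_imp (sure_finish_single aAT) _.
  move=> q o [_ ->]; rewrite splitc mulnDl; move: ((124 + _) * _) => Y.
  by move: (#|V| * k * K.+1) q1le q2le nk => X; clear; lia.
have {}AT : [disjoint A & T].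
  by rewrite -setI_eq0; apply/eqP/setP => v; rewrite in_set0; exact: AT.
rewrite -[X in whp _ _ X]add0r.
apply: whp_bind (whp_sure _ (sure_visit_sources AT)) _ => //.
move=> q3 [F E] [st q3le].
apply: whp_imp (whp_search S_common V_small R K (c * k) #|V|.+1 AT st) _.
move=> q _ H; have {}H : q <= (124 + 18 * c) * (#|V| * k * K.+1).
  apply: search_cost_le H => //; last exact: max_card.
  by apply: leq_trans SK; rewrite subset_leq_card // subsetDl.
have : k * #|V| <= #|V| * k * K.+1 by rewrite [k * _]mulnC leq_pmulr.
rewrite splitc mulnDl; move: ((124 + _) * _) H => Y.
by move: (#|V| * k * K.+1) q1le q2le q3le nk => X; clear; lia.
Qed.

End Augment.

(** Increase K only when [r] is exactly the square of K+1; then K+2 <= 2(K+1) keeps the upper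
    bound. *)
Lemma square_root_approx r :
  exists K, r <= K.+1 ^ 2 /\ K.+1 ^ 2 <= 4 * maxn 1 r.
Proof.
elim: r => [|r [K [rK Kr]]]; first by exists 0.
have [lt|ge] := ltnP r (K.+1 ^ 2).
  by exists K; split=> //; move: Kr; clear; lia.
have rE : r = K.+1 ^ 2 by apply/eqP; rewrite eqn_leq rK.
exists K.+1; rewrite -!mulnn in rE *; move: rE; clear => ->; split; nia.
Qed.

(** * Logarithms, failure probability and choice of constants *)

Local Open Scope ring_scope.

(** Rounding up adds less than one binary digit, absorbed by the factor 2 because n >= 2. *)
Lemma up_log_le_ln (R : realType) n : (1 < n)%N ->
  (up_log 2 n)%:R <= 2 / ln 2 * ln n%:R :> R.
Proof.
move=> n1; have l2 : 0 < ln 2 :> R by rewrite ln_gt0 // ltr1n.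
have /andP[lo _] := up_log_bounds (ltnSn 1) n1.
have k0 : (0 < up_log 2 n)%N by rewrite up_log_gt0.
rewrite mulrAC ler_pdivlMr //.
have h1 : ln 2 <= ln n%:R :> R.
  by rewrite ler_ln ?posrE ?ltr0n ?ler_nat // (ltn_trans _ n1).
have h2 : (up_log 2 n).-1%:R * ln 2 <= ln n%:R :> R.
  rewrite mulr_natl -lnXn ?ltr0n // ler_ln ?posrE ?exprn_gt0 ?ltr0n //.
  - by rewrite -natrX ler_nat ltnW.
  - exact: ltn_trans n1.
rewrite -(prednK k0) -natr1; lra.
Qed.

(** Three of the powers of n absorb the union bound, as (n+1) n <= n^3. *)
Lemma failure_le (R : realType) (c : R) n (k c0 : nat) : (1 < n)%N ->
  (n <= 2 ^ k)%N -> c <= c0%:R ->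
  n.+1%:R * (n%:R * 2 ^- ((3 + c0) * k)) <= n%:R `^ (- c) :> R.
Proof.
move=> n1 nk cc0; have n0 : 0 < n%:R :> R by rewrite ltr0n (ltn_trans _ n1).
apply: (@le_trans _ _ (n%:R ^- c0)); last first.
  rewrite -powR_mulrn ?(ltW n0) // -powRN.
  apply: ler_powR; last by rewrite lerN2.
  by rewrite ler1n (ltn_trans _ n1).
have h : 2 ^- ((3 + c0) * k) <= n%:R ^- (3 + c0) :> R.
  rewrite lef_pV2 ?posrE ?exprn_gt0 ?n0 ?ltr0n // mulnC exprM.
  by rewrite lerXn2r ?nnegrE ?exprn_ge0 // -natrX ler_nat.
apply: (@le_trans _ _ (n.+1%:R * (n%:R * n%:R ^- (3 + c0)))).
  by rewrite !ler_wpM2l.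
rewrite exprD invfM !mulrA ler_piMl ?invr_ge0 ?exprn_ge0 ?(ltW n0) //.
rewrite ler_pdivrMr ?exprn_gt0 // mul1r -natrM -natrX ler_nat.
by rewrite !expnS expn0 muln1; nia.
Qed.

Theorem theorem3p1 (R : realType) (c : R) (hc : 0 < c) :
  exists (C : R) (alg : forall V : finType, {set V} -> oracle_alg V (outcome V)),
    0 < C /\
    forall (V : finType) (M1 M2 : matroid V) (S : {set V}),
      common_indep M1 M2 S ->
      prob R M1 M2 (alg V S) (fun _ o => correct_outcome M1 M2 S o) = 1 /\
      1 - #|V|%:R `^ (- c) <=
        prob R M1 M2 (alg V S) (fun q _ => q%:R <= query_bound C S).
Proof.
have l2 : 0 < ln 2 :> R by rewrite ln_gt0 // ltr1n.
pose c0 := Num.bound c; pose c1 := (3 + c0)%N.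
pose N := (129 + 18 * c1)%N.
(* Of the factor 4 / ln 2, a part 2 / ln 2 comes from [up_log_le_ln] and a part 2 from
   [square_root_approx]. *)
exists (N%:R * 4 / ln 2), (fun (V : finType) (S : {set V}) =>
  if #|V| == 0%N then Return V (IsMaximum V) else
  augment S (up_log 2 #|V|) (sval (cid (square_root_approx #|S|)))
    (c1 * up_log 2 #|V|)).
split; first by rewrite !mulr_gt0 ?invr_gt0 // ltr0n.
move=> V M1 M2 S SI; case: eqP => [V0|/eqP].
  have noV (X : {set V}) : #|X| = 0%N.
    by apply/eqP; rewrite -leqn0 -V0 max_card.
  have maxS : max_common_indep M1 M2 S.
    by split=> // X _; rewrite !noV.
  split; first by rewrite sure_prob.
  have Ve : #|V|%:R = 0 :> R by rewrite V0.
  rewrite /= asboolT; first by rewrite lerBlDr lerDl powR_ge0.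
  by rewrite /query_bound Ve mulr0 !mul0r.
rewrite -lt0n => V0; have Vk := up_logP #|V| (ltnSn 1).
split; first by rewrite sure_prob //; exact: sure_augment.
(* For a single element ln 1 = 0 allows no query, but the required probability 1 - 1 is 0. *)
have [V1|V1] := leqP #|V| 1.
  have -> : #|V| = 1%N by apply/eqP; rewrite eqn_leq V1.
  by rewrite powR1 subrr prob_ge0.
case: cid => K /= [SK KS].
have k0 : (0 < up_log 2 #|V|)%N by rewrite up_log_gt0.
have := whp_augment SI Vk R c1 SK k0; rewrite /whp => H.
apply: le_trans (le_trans H _).
  rewrite lerD2l lerN2; apply: failure_le => //.
  by apply: ltW; exact: archi_boundP (ltW hc).
apply: prob_le => q _ qle.
apply: (@le_trans _ _ (N * (#|V| * up_log 2 #|V| * K.+1))%:R).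
  by rewrite ler_nat.
have sq : K.+1%:R <= 2 * Num.sqrt (maxn 1 #|S|)%:R :> R.
  rewrite -(@ler_pXn2r _ 2) ?nnegrE ?mulr_ge0 ?sqrtr_ge0 //.
  by rewrite exprMn sqr_sqrtr // -!natrX -natrM ler_nat.
have kl := up_log_le_ln R V1.
rewrite /query_bound !natrM.
apply: (@le_trans _ _ (N%:R * (#|V|%:R * (2 / ln 2 * ln #|V|%:R) *
                         (2 * Num.sqrt (maxn 1 #|S|)%:R)))).
  by rewrite ler_wpM2l // ler_pM ?mulr_ge0 // ler_wpM2l.
by rewrite le_eqVlt; apply/orP; left; apply/eqP; ring.
Qed.
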